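(* Consider the stochastic minimax problem $\min_{x\in\mathbb{R}^d}\max_{y\in\mathbb{R}^p} f(x,y)$ with $f(x,y)=\mathbb{E}_{\xi\sim\mathcal{D}}[f(x,y;\xi)]$, and let $F(x)=\max_{y}f(x,y)$. Assume: (A1) there is $\mu>0$ such that for every $x$ the set $\arg\max_y f(x,y)$ is nonempty and $\|\nabla_y f(x,y)\|^2\ge 2\mu\big(\max_{y'}f(x,y')-f(x,y)\big)$ for all $y$; (A2) for every $\xi$, the maps $\nabla_x f(\cdot,\cdot;\xi)$ and $\nabla_y f(\cdot,\cdot;\xi)$ are $L_f$-Lipschitz in each argument separately, i.e. $\|\nabla_x f(x_1,y;\xi)-\nabla_x f(x_2,y;\xi)\|\le L_f\|x_1-x_2\|$, $\|\nabla_x f(x,y_1;\xi)-\nabla_x f(x,y_2;\xi)\|\le L_f\|y_1-y_2\|$, and the same two inequalities with $\nabla_y$ in place of $\nabla_x$, for all $x,x_1,x_2,y,y_1,y_2$; (A3) $\mathbb{E}_\xi[\nabla f(x,y;\xi)]=\nabla f(x,y)$ and $\mathbb{E}_\xi\|\nabla f(x,y)-\nabla f(x,y;\xi)\|^2\le\sigma^2$ for all $x,y$, where $\nabla f=(\nabla_x f,\nabla_y f)$; (A4) $F^*=\inf_x F(x)>-\infty$. Let $\{x_t,y_t,\tilde x_t,w_t,v_t\}$ be generated by the MSGDA algorithm (described in the context) with $\eta_t=\frac{k}{(m+t)^{1/3}}$ for all $t\ge 0$, $\alpha_{t+1}=c_1\eta_t^2$, $\beta_{t+1}=c_2\eta_t^2$,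 where $k>0$, $m\ge\max\big(2,k^3,(c_1k)^3,(c_2k)^3\big)$, $c_1\ge\frac{2}{3k^3}+\frac{9L_f^2}{\mu^2}$, $c_2\ge\frac{2}{3k^3}+\frac94$, $0<\lambda\le\min\big(\frac{3}{4\sqrt2\,\mu},\frac{m^{1/3}}{2L_fk}\big)$ and $0<\gamma\le\min\big(\frac{\lambda\mu}{16L},\frac{1}{2L_f\sqrt{8+9/(8\lambda\mu^2)}}\big)$. Then for every $T\ge1$, $$\frac1T\sum_{t=1}^T\mathbb{E}\|\nabla F(x_t)\|\le\frac1T\sum_{t=1}^T\mathbb{E}[\mathcal{G}_t]\le\frac{2\sqrt{3H}\,m^{1/6}}{T^{1/2}}+\frac{2\sqrt{3H}}{T^{1/3}},$$ where $H=\frac{F(x_1)-F^*}{\gamma k}+\frac{9L_f^2}{k\lambda\mu^2}\Delta_1+\frac{2\sigma^2m^{1/3}}{k^2}+2k^2(c_1^2+c_2^2)\sigma^2\ln(m+T)$ and $\Delta_1=F(x_1)-f(x_1,y_1)$.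
   Context: $\kappa=L_f/\mu$ and $L=L_f(1+\kappa/2)$. For each $x$, $y^*(x)$ denotes an element of $\arg\max_y f(x,y)$, so $F(x)=f(x,y^*(x))$. MSGDA algorithm: given constants $\gamma,\lambda>0$, sequences $\eta_t>0$ and $\alpha_t,\beta_t\in(0,1]$, initial points $x_1\in\mathbb{R}^d,y_1\in\mathbb{R}^p$, and samples $\xi_1,\xi_2,\dots$ drawn i.i.d. from $\mathcal{D}$: set $v_1=\nabla_y f(x_1,y_1;\xi_1)$, $w_1=\nabla_x f(x_1,y_1;\xi_1)$, and for $t\ge1$: $\tilde y_{t+1}=y_t+\lambda v_t$, $\tilde x_{t+1}=x_t-\gamma w_t$; $y_{t+1}=y_t+\eta_t(\tilde y_{t+1}-y_t)$, $x_{t+1}=x_t+\eta_t(\tilde x_{t+1}-x_t)$; $v_{t+1}=\nabla_y f(x_{t+1},y_{t+1};\xi_{t+1})+(1-\alpha_{t+1})[v_t-\nabla_y f(x_t,y_t;\xi_{t+1})]$; $w_{t+1}=\nabla_x f(x_{t+1},y_{t+1};\xi_{t+1})+(1-\beta_{t+1})[w_t-\nabla_x f(x_t,y_t;\xi_{t+1})]$. The metric is $\mathcal{G}_t=\frac1\gamma\|x_t-\tilde x_{t+1}\|+\frac{\sqrt2L_f}{\sqrt\mu}\sqrt{F(x_t)-f(x_t,y_t)}+\|\nabla_x f(x_t,y_t)-w_t\|$. *)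

(* Defs.v *)
From HB Require Import structures.
From mathcomp Require Import all_boot all_order all_algebra.
From mathcomp Require Import all_classical all_reals all_analysis.
Set Implicit Arguments. Unset Strict Implicit. Unset Printing Implicit Defensive.
Import Order.TTheory GRing.Theory Num.Theory.
Import numFieldNormedType.Exports.
Local Open Scope classical_set_scope.
Local Open Scope ring_scope.

Section Defs.
Variable R : realType.

Definition enorm (n : nat) (v : 'rV[R]_n) : R :=
  Num.sqrt (\sum_(i < n) v ord0 i ^+ 2).

Definition gradient (n : nat) (F : 'rV[R]_n -> R) (x : 'rV[R]_n) : 'rV[R]_n :=
  \row_(i < n) ('D_(delta_mx ord0 i) F x).

Definition gradx (d p : nat) (g : 'rV[R]_d -> 'rV[R]_p -> R) x y : 'rV[R]_d :=
  gradient (fun x' => g x' y) x.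
Definition grady (d p : nat) (g : 'rV[R]_d -> 'rV[R]_p -> R) x y : 'rV[R]_p :=
  gradient (fun y' => g x y') y.

Definition iid_samples (dO dX : measure_display) (O : measurableType dO)
  (X : measurableType dX) (P : probability O R) (D : probability X R)
  (xi : nat -> O -> X) : Prop :=
  (forall t, measurable_fun setT (xi t)) /\
  forall (n : nat) (A : nat -> set X), (forall i, measurable (A i)) ->
    P (\bigcap_(i in [set i | (0 < i <= n)%N]) (xi i @^-1` A i)) =
    (\prod_(1 <= i < n.+1) D (A i))%E.

(* the metric G_t of the paper, with xtil = x_t - gamma w_t *)
Definition Gmetric (d p : nat) (f : 'rV[R]_d -> 'rV[R]_p -> R) (F : 'rV[R]_d -> R)
  (gamma mu Lf : R) (xt : 'rV[R]_d) (yt : 'rV[R]_p) (wt xtil : 'rV[R]_d) : R :=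
  gamma^-1 * enorm (xt - xtil)
  + (Num.sqrt 2 * Lf / Num.sqrt mu) * Num.sqrt (F xt - f xt yt)
  + enorm (gradx f xt yt - wt).

End Defs.

(* Main.v *)
(** The PL inequality at an old maximizer bounds the growth of the value function
    [F = max_y f] from above by a quadratic, and [F >= f] bounds it from below, so
    [F] is differentiable with [grad F (x) = grad_x f (x, ys)] and smoothness
    constant [Lf (1 + kappa)]. This is larger than the [L = Lf (1 + kappa / 2)] of
    the step-size conditions, but at most [2 L], which the conditions tolerate.
    Gradient ascent in [y] with vanishing step gives the quadratic-growth
    consequence [|grad F - grad_x f|^2 <= (2 Lf^2 / mu) (F - f)] and hence the
    first inequality.

    For the second one, the Lyapunov function is
    [F - F* + A (F - f) + (gamma / eta_{t-1}) (|grad_y f - v|^2 + |grad_x f - w|^2)]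
    with [A = 9 gamma Lf^2 / (lambda mu^2)]. Tonelli's theorem on the product of
    the sigma-algebra of the first [t] samples with a fresh sample gives the
    contraction of the momentum errors in expectation; all other estimates are
    pointwise. Everything is nonnegative, so the telescoping takes place in the
    extended reals and no integrability of the iterates is needed. *)

Require Import Defs.
From HB Require Import structures.
From mathcomp Require Import all_boot all_order all_algebra.
From mathcomp Require Import all_classical all_reals all_analysis.
From mathcomp Require Import measurable_realfun ring lra.
Import Order.TTheory GRing.Theory Num.Theory.
Import numFieldNormedType.Exports.
Set Implicit Arguments.
Unset Strict Implicit.
Unset Printing Implicit Defensive.
Local Open Scope classical_set_scope.
Local Open Scope ring_scope.

(** * Euclidean norm *)

Section euclidean.
Context {R : realType}.

(** The constants come from a budget. An ascent step shrinks the gap by the factor [1 - eta lam mu],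
    and [A] is chosen so that this releases nine units [z = gam eta (Lf^2 / mu) (F - f)]: two pay
    for replacing [grad F] by [grad_x f] in the descent of [F], six for the same replacement in the
    growth of the gap, one half for the metric. In [c1] and [c2] the summand [2 / (3 k^3)] absorbs
    the growth of [1 / eta]; [9 Lf^2 / mu^2 = A lam / gam] is the price of the error of [v], and
    [9 / 4] covers the error of [w]. The bound on [|grad F - grad_x f|] has the constant that the
    distance to the argmax set would give. The ascent argument acts on the inequality itself, for
    all [y] at once: a bound with one constant implies a bound with a smaller one. Only the
    constants pass to a limit, never a trajectory, so no limit point has to be found. *)

Definition dotp n (u v : 'rV[R]_n) : R := \sum_(i < n) u ord0 i * v ord0 i.

Section dotp_theory.
Variable n : nat.
Implicit Types (u v w : 'rV[R]_n) (a : R).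

Lemma dotpC u v : dotp u v = dotp v u.
Proof. by apply: eq_bigr => i _; rewrite mulrC. Qed.

Lemma dotpDl u v w : dotp (u + v) w = dotp u w + dotp v w.
Proof. by rewrite -big_split; apply: eq_bigr => i _; rewrite mxE mulrDl. Qed.

Lemma dotpDr u v w : dotp w (u + v) = dotp w u + dotp w v.
Proof. by rewrite dotpC dotpDl !(dotpC w). Qed.

Lemma dotpZl a u v : dotp (a *: u) v = a * dotp u v.
Proof. by rewrite mulr_sumr; apply: eq_bigr => i _; rewrite mxE mulrA. Qed.

Lemma dotpZr a u v : dotp u (a *: v) = a * dotp u v.
Proof. by rewrite dotpC dotpZl dotpC. Qed.

Lemma dotpNl u v : dotp (- u) v = - dotp u v.
Proof. by rewrite -scaleN1r dotpZl mulN1r. Qed.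

Lemma dotpNr u v : dotp u (- v) = - dotp u v.
Proof. by rewrite dotpC dotpNl dotpC. Qed.

Lemma dotp_ge0 u : 0 <= dotp u u.
Proof. by apply: sumr_ge0 => i _; rewrite -expr2 sqr_ge0. Qed.

Lemma dotp_delta u i : dotp u (delta_mx ord0 i) = u ord0 i.
Proof.
rewrite /dotp (bigD1 i)//= mxE !eqxx mulr1 big1 ?addr0// => j ji.
by rewrite mxE (negbTE ji) andbF mulr0.
Qed.

Lemma enorm_ge0 u : 0 <= enorm u.
Proof. exact: sqrtr_ge0. Qed.

Lemma enorm_sqr u : enorm u ^+ 2 = dotp u u.
Proof.
rewrite /enorm sqr_sqrtr; first by apply: eq_bigr => i _; rewrite expr2.
by apply: sumr_ge0 => i _; rewrite sqr_ge0.
Qed.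

Lemma dotp_eq0 u : (dotp u u == 0) = (u == 0).
Proof.
apply/idP/eqP => [|->]; last by rewrite -(scale0r u) dotpZl mul0r.
rewrite psumr_eq0 => [/allP h|i _]; last by rewrite -expr2 sqr_ge0.
apply/rowP => i; rewrite mxE; apply/eqP.
by have := h i (mem_index_enum i); rewrite -expr2 sqrf_eq0.
Qed.

Lemma CauchySchwarz_dotp u v : dotp u v ^+ 2 <= dotp u u * dotp v v.
Proof.
have [v0|v0] := eqVneq (dotp v v) 0.
  have /eqP -> : v == 0 by rewrite -dotp_eq0 v0.
  by rewrite -(scale0r u) !dotpZr !mul0r expr0n mulr0.
have vp : 0 < dotp v v by rewrite lt_def v0 dotp_ge0.
(* This square expands to [b (a b - c^2)] in the notation set below. *)
have := dotp_ge0 (dotp v v *: u - dotp u v *: v).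
rewrite !(dotpDl, dotpDr, dotpZl, dotpZr, dotpNl, dotpNr) (dotpC v u).
set a := dotp u u; set b := dotp v v; set c := dotp u v.
move=> h; have : 0 <= b * (a * b - c ^+ 2) by move: h; lra.
by rewrite pmulr_rge0// subr_ge0.
Qed.

Lemma dotp_le_enorm u v : dotp u v <= enorm u * enorm v.
Proof.
have := CauchySchwarz_dotp u v; rewrite -!enorm_sqr -exprMn => h.
apply: le_trans (ler_norm _) _.
rewrite -(@ler_pXn2r _ 2) ?nnegrE ?mulr_ge0 ?enorm_ge0//.
by rewrite real_normK ?num_real.
Qed.

Lemma enormZ a u : enorm (a *: u) = `|a| * enorm u.
Proof.
apply/eqP; rewrite -(@eqrXn2 _ 2) ?mulr_ge0 ?enorm_ge0//.
by rewrite exprMn !enorm_sqr dotpZl dotpZr mulrA real_normK ?num_real// expr2.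
Qed.

Lemma enormN u : enorm (- u) = enorm u.
Proof. by rewrite -scaleN1r enormZ normrN1 mul1r. Qed.

Lemma enormD u v : enorm (u + v) <= enorm u + enorm v.
Proof.
rewrite -(@ler_pXn2r _ 2) ?nnegrE ?addr_ge0 ?enorm_ge0//.
rewrite sqrrD !enorm_sqr !(dotpDl, dotpDr) (dotpC v u).
by have := dotp_le_enorm u v; lra.
Qed.

Lemma normr_le_enorm u i : `|u ord0 i| <= enorm u.
Proof.
rewrite -(@ler_pXn2r _ 2) ?nnegrE ?enorm_ge0// real_normK ?num_real//.
rewrite enorm_sqr /dotp (bigD1 i)//= -expr2 lerDl.
by apply: sumr_ge0 => j _; rewrite -expr2 sqr_ge0.
Qed.

(** The norm of a row is the maximum norm, and it defines the topology. This comparison carries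
    Euclidean estimates over to continuity and differentiability, where the crude factor [n] does no
    harm. *)
Lemma enorm_le_mx_norm u : enorm u <= n%:R * `|u|.
Proof.
apply: (@le_trans _ _ (\sum_(i < n) `|u ord0 i|)).
  rewrite {1}(row_sum_delta u).
  elim/big_ind2 : _ => [||i _]; first by rewrite -(scale0r 0) enormZ normr0 mul0r.
    by move=> a b c d ab cd; exact: le_trans (enormD _ _) (lerD ab cd).
  rewrite enormZ (_ : enorm _ = 1) ?mulr1//.
  apply/eqP; rewrite -(@eqrXn2 _ 2) ?enorm_ge0// enorm_sqr dotp_delta mxE !eqxx.
  by rewrite expr1n.
rewrite mulr_natl -[X in _ *+ X]card_ord -sumr_const; apply: ler_sum => i _.
by rewrite [leRHS]/Num.Def.normr /= mx_normrE; apply: (le_bigmax _ (fun ij => `|u ij.1 ij.2|)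
  (ord0, i)).
Qed.

End dotp_theory.
End euclidean.

(** * Smooth functions *)

Lemma is_diff_quad (R : realType) (V W : normedModType R) (f : V -> W)
    (df : {linear V -> W}) (x : V) (C : R) : continuous df ->
  (forall u, `|f (u + x) - f x - df u| <= C * `|u| ^+ 2) ->
  differentiable f x /\ 'd f x = df :> (V -> W).
Proof.
move=> dc H.
have fo : f \o shift x = cst (f x) + df +o_ 0 id.
  apply/eqaddoP => e e0; apply/nbhs_ballP.
  have C0 : 0 < `|C| + 1 by rewrite ltr_wpDl.
  exists (e / (`|C| + 1)); rewrite /= ?divr_gt0// => u.
  rewrite -ball_normE /= sub0r normrN ltr_pdivlMr// => /ltW ue.
  rewrite -[(_ + _) u]/(_ + _) -[(- _) u]/(- _) opprD addrA /=.
  apply: (le_trans (H u)); rewrite expr2 mulrA ler_wpM2r//.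
  apply: le_trans ue; rewrite (mulrC `|u|) ler_wpM2r//.
  by apply: le_trans (ler_norm _) _; rewrite lerDl.
have dE : 'd f x = df :> (V -> W) by exact: diff_unique.
by split => //; apply/diff_locallyP; rewrite dE.
Qed.

Section smooth_functions.
Context {R : realType} (n : nat).
Implicit Types (F : 'rV[R]_n -> R) (x u g : 'rV[R]_n) (C : R).

Lemma dotp_is_linear g : linear (dotp g).
Proof. by move=> a u v; rewrite dotpDr dotpZr. Qed.

HB.instance Definition _ g :=
  GRing.isLinear.Build R 'rV[R]_n R *:%R (dotp g) (dotp_is_linear g).

Lemma derive_dotp F x u : differentiable F x ->
  'D_u F x = dotp (gradient F x) u.
Proof.
move=> dF; rewrite deriveE// {1}(row_sum_delta u) linear_sum.
by apply: eq_bigr => i _; rewrite linearZ mxE deriveE// mulrC.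
Qed.

Lemma gradientN F x : differentiable F x ->
  gradient (fun z => - F z) x = - gradient F x.
Proof.
move=> dF; apply/rowP => i; rewrite !mxE.
by rewrite deriveN//; exact: diff_derivable.
Qed.

Lemma is_derive_line F x u (t : R) : differentiable F (t *: u + x) ->
  is_derive t 1 (fun s => F (s *: u + x)) (dotp (gradient F (t *: u + x)) u).
Proof.
move=> dF; have E : (fun h : R => h^-1 *: (((fun s => F (s *: u + x)) \o shift t) (h *: 1) - F
  (t *: u + x)))
   = (fun h : R => h^-1 *: ((F \o shift (t *: u + x)) (h *: u) - F (t *: u + x))).
  by apply/funext => h /=; rewrite -[h *: 1]/(h * 1) mulr1 scalerDl addrA.
have H : derivable F (t *: u + x) u by exact: diff_derivable.
split; first by rewrite /derivable E; exact: H.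
by rewrite -derive_dotp// /derive E.
Qed.

Definition grad_lipschitz C F := forall x x',
  enorm (gradient F x - gradient F x') <= C * enorm (x - x').

Lemma grad_lipschitz_ub C F x u : (forall x, differentiable F x) ->
  grad_lipschitz C F ->
  F (x + u) <= F x + dotp (gradient F x) u + C / 2 * dotp u u.
Proof.
move=> dF lF.
(* [q] is [F] along the segment minus the nonconstant part of its quadratic model. The claim is
   [q 1 <= q 0], which the mean value theorem reduces to the sign of [q']. *)
pose q : R -> R := fun t => F (t *: u + x) - (t * dotp (gradient F x) u + t * t * (C / 2 * dotp
  u u)).
pose q' (t : R) : R := dotp (gradient F (t *: u + x)) u - (dotp (gradient F x) u + (t + t) * (C
  / 2 * dotp u u)).
have dl (a t : R) : is_derive t (1 : R) (fun t : R => t * a) a.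
  have h := @is_deriveM R R id (cst a) t 1 1 0 (is_derive_id _ _) (is_derive_cst _ _ _).
  by apply: (is_derive_eq h); rewrite scaler0 add0r /GRing.scale/= mulr1.
have dsq (t : R) : is_derive t (1 : R) (fun t : R => t * t) (t + t).
  have h := @is_deriveM R R id id t 1 1 1 (is_derive_id _ _) (is_derive_id _ _).
  by apply: (is_derive_eq h); rewrite /GRing.scale/= mulr1.
have dq (t : R) : is_derive t (1 : R) q (q' t).
  have h := @is_deriveM R R (fun t => t * t) (cst (C / 2 * dotp u u)) t 1 (t + t) 0 (dsq t)
    (is_derive_cst _ _ _).
  have h2 : is_derive t (1 : R) (fun t => t * t * (C / 2 * dotp u u)) ((t + t) * (C / 2 * dotp
    u u)).
    by apply: (is_derive_eq h); rewrite scaler0 add0r /GRing.scale/= mulrC.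
  exact: (is_deriveB (is_derive_line (dF _)) (is_deriveD (dl _ t) h2)).
have q'le t : 0 <= t -> q' t <= 0.
  move=> t0; rewrite /q'; have := dotp_le_enorm (gradient F (t *: u + x) - gradient F x) u.
  have := lF (t *: u + x) x; rewrite addrK enormZ ger0_norm// => h1.
  have := enorm_sqr u; have := enorm_ge0 u; rewrite dotpDl dotpNl.
  move: h1; set N := enorm _; set U := enorm u; set d1 := dotp _ _; set d2 := dotp _ _ => h1 U0
    UE h2.
  have : N * U <= C * (t * U) * U by rewrite ler_wpM2r.
  by rewrite -UE; lra.
have [c cin E] : exists2 c, c \in `]0%R, 1%R[ & q 1 - q 0 = q' c * (1 - 0).
  apply: MVT => //; apply: derivable_within_continuous => t _.
  by have [] := dq t.
move: cin; rewrite in_itv/= => /andP[c0 _].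
have := q'le c (ltW c0); move: E; rewrite /q scale1r scale0r add0r (addrC u x); lra.
Qed.

Lemma grad_lipschitz_lb C F x u : (forall x, differentiable F x) ->
  grad_lipschitz C F ->
  F x + dotp (gradient F x) u - C / 2 * dotp u u <= F (x + u).
Proof.
move=> dF lF; have := @grad_lipschitz_ub C (fun z => - F z) x u.
rewrite gradientN// dotpNl => H; suff: - F (x + u) <= - F x - dotp (gradient F x) u + C / 2 *
  dotp u u by lra.
apply: H => [z|z z']; first exact: differentiableN.
by rewrite !gradientN// -opprD enormN; exact: lF.
Qed.

Lemma lipschitz_continuous F C :
  (forall x x', `|F x - F x'| <= C * enorm (x - x')) -> continuous F.
Proof.
move=> H x; apply/(@cvgrPdist_le _ _ _ (nbhs x) (nbhs_filter x)) => e e0; apply/nbhs_ballP.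
have C0 : 0 < `|C| * n%:R + 1 by rewrite ltr_wpDl// mulr_ge0.
exists (e / (`|C| * n%:R + 1)); rewrite /= ?divr_gt0// => z.
rewrite -ball_normE /= ltr_pdivlMr// => /ltW zx.
apply: (le_trans (H _ _)).
apply: (@le_trans _ _ (`|C| * (n%:R * `|x - z|))).
  apply: (@le_trans _ _ (`|C| * enorm (x - z))).
    by rewrite ler_wpM2r ?enorm_ge0// ler_norm.
  by rewrite ler_wpM2l// enorm_le_mx_norm.
apply: le_trans zx; rewrite (mulrC `|x - z|) mulrA ler_wpM2r//.
by rewrite lerDl.
Qed.

(** The linear part of a two-sided quadratic bound must be the gradient. This differentiates a
    maximum without any regularity of the maximizer. *)
Lemma differentiable_quad F x g C :
  (forall u, `|F (x + u) - F x - dotp g u| <= C * dotp u u) ->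
  differentiable F x /\ gradient F x = g.
Proof.
move=> H.
have dc : continuous (dotp g).
  apply: (@lipschitz_continuous _ (enorm g)) => u v.
  rewrite ler_norml -dotpNr -dotpDr dotp_le_enorm andbT lerNl -dotpNr.
  by rewrite -(enormN (u - v)) dotp_le_enorm.
have Hq u : `|F (u + x) - F x - dotp g u| <= `|C| * n%:R ^+ 2 * `|u| ^+ 2.
  rewrite (addrC u x); apply: (le_trans (H u)).
  apply: (@le_trans _ _ (`|C| * dotp u u)).
    by rewrite ler_wpM2r ?dotp_ge0// ler_norm.
  rewrite -mulrA ler_wpM2l// -enorm_sqr -exprMn ler_pXn2r ?nnegrE ?enorm_ge0 ?mulr_ge0//.
  exact: enorm_le_mx_norm.
have [dF dE] := is_diff_quad dc Hq.
by split => //; apply/rowP => i; rewrite mxE deriveE// dE; exact: dotp_delta.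
Qed.

End smooth_functions.

(** * Value function and descent *)

(** Everything charged to [eta gam |w|^2] in one step: smoothness of [F], Young's inequality, the
    change of the gap under the [x] step, the drift of [grad_y f], and the drift of the two momentum
    errors. The descent of [F] supplies [1/2]; the metric takes [1/4], so [1/4] remains for these
    five terms. *)
Lemma step_size_budget (R : realType) (Lf mu lam gam eta A : R) :
  0 < mu -> 0 < Lf -> 0 < lam -> 0 < gam -> 0 < eta <= 1 ->
  32 * (lam * mu) ^+ 2 <= 9 -> 8 * gam * (Lf * (2 + Lf / mu)) <= lam * mu ->
  A = 9 * gam * Lf ^+ 2 / (lam * mu ^+ 2) ->
  Lf * (1 + Lf / mu) / 2 * eta * gam + A ^+ 2 / 12
  + A * (Lf * (2 + Lf / mu) / 2 * eta * gam) + A * (lam * Lf ^+ 2 * eta ^+ 2 * gam)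
  + 8 * Lf ^+ 2 * gam ^+ 2 <= 4^-1.
Proof.
move=> mu0 Lf0 lam0 gam0 /andP[eta0 eta1] hr hg AE.
set rho := lam * mu in hr hg; pose a := Lf * gam; pose b := Lf ^+ 2 * gam / mu.
have rho0 : 0 < rho by rewrite mulr_gt0.
have a0 : 0 < a by rewrite mulr_gt0.
have b0 : 0 < b by rewrite divr_gt0 ?mulr_gt0 ?exprn_gt0.
have muN : mu != 0 by rewrite gt_eqF.
have lamN : lam != 0 by rewrite gt_eqF.
have hab : 8 * (2 * a + b) <= rho.
  by apply: le_trans hg; rewrite le_eqVlt; apply/orP; left; apply/eqP; rewrite /a /b; field.
have Arho : A * rho = 9 * b by rewrite AE /rho /b; field; rewrite muN lamN.
have A0 : 0 < A by rewrite AE divr_gt0 ?mulr_gt0 ?exprn_gt0.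
have A98 : A <= 9 / 8.
  by rewrite -(ler_pM2r rho0) Arho; lra.
(* A rational number just above [3 / (4 sqrt 2)], the bound that [hr] puts on [rho]. *)
have rho53 : rho <= 8 / 15.
  have c0 : 0 <= 8 / 15 :> R by lra.
  have cE : (8 / 15) ^+ 2 = 64 / 225 :> R by field.
  by rewrite -(@ler_pXn2r _ 2) ?nnegrE ?(ltW rho0)// cE; move: hr; lra.
have t1 : Lf * (1 + Lf / mu) / 2 * eta * gam <= (a + b) / 2.
  have -> : Lf * (1 + Lf / mu) / 2 * eta * gam = (a + b) / 2 * eta by rewrite /a /b; field.
  by rewrite ler_piMr//; lra.
have t3 : A * (Lf * (2 + Lf / mu) / 2 * eta * gam) <= 9 / 8 * ((2 * a + b) / 2).
  have -> : Lf * (2 + Lf / mu) / 2 * eta * gam = (2 * a + b) / 2 * eta by rewrite /a /b; field.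
  apply: ler_pM => //; [exact: ltW|by rewrite mulr_ge0//; lra|].
  by rewrite ler_piMr//; lra.
have t4 : A * (lam * Lf ^+ 2 * eta ^+ 2 * gam) <= 9 * b ^+ 2.
  have -> : A * (lam * Lf ^+ 2 * eta ^+ 2 * gam) = A * rho * b * eta ^+ 2.
    by rewrite /rho /b; field.
  have -> : 9 * b ^+ 2 = 9 * b * b by ring.
  have eta2 : eta ^+ 2 <= 1 by rewrite expr_le1// ltW.
  have b90 : 0 <= 9 * b by rewrite mulr_ge0// ltW.
  have b2 : 0 <= 9 * b * b by rewrite mulr_ge0// ltW.
  by rewrite Arho ler_piMr.
have t5 : 8 * Lf ^+ 2 * gam ^+ 2 = 8 * a ^+ 2 by rewrite /a; ring.
have A2 : A ^+ 2 <= 81 / 64.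
  have -> : 81 / 64 = (9 / 8) ^+ 2 :> R by field.
  by rewrite ler_pXn2r ?nnegrE ?(ltW A0)//; lra.
have sqr_le (u v : R) : 0 <= u -> u <= v -> u ^+ 2 <= v ^+ 2.
  by move=> u0 uv; rewrite ler_pXn2r// nnegrE// (le_trans u0).
have b2 : b ^+ 2 <= (rho / 8) ^+ 2 by apply: sqr_le; lra.
have a2 : a ^+ 2 <= (rho / 16) ^+ 2 by apply: sqr_le; lra.
by rewrite t5; move: t1 t3 t4 A2 b2 a2 hab rho53 hr; lra.
Qed.

(** The descent estimate with the vectors abstracted away: [W], [V] stand for [|w|^2], [|v|^2]; [N]
    for [|grad F - grad_x f|^2]; [e], [r] for the squared errors of [v], [w]; [dl] for the gap;
    [GW], [gw], [hv] for the inner products of [grad F], [grad_x f] with [w] and of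
    [grad_y f (x', y)] with [v]. *)
Lemma descent_scalar (R : realType) (Lf mu lam gam eta A : R)
    (W V N e r dl Fx Fx' fx'y fx'y' GW gw hv : R) :
  0 < mu -> 0 < Lf -> 0 < lam -> 0 < gam -> 0 < eta <= 1 ->
  32 * (lam * mu) ^+ 2 <= 9 -> 8 * gam * (Lf * (2 + Lf / mu)) <= lam * mu ->
  2 * (eta * lam * Lf) <= 1 ->
  A = 9 * gam * Lf ^+ 2 / (lam * mu ^+ 2) ->
  0 <= W -> 0 <= V -> 0 <= N -> 0 <= dl ->
  N <= 2 * Lf ^+ 2 / mu * dl ->
  - GW <= N + r - W / 2 ->
  A * (gw - GW) <= A ^+ 2 / 12 * W + 3 * N ->
  Fx' <= Fx - eta * gam * GW + Lf * (1 + Lf / mu) / 2 * (eta * gam) ^+ 2 * W ->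
  (Fx - dl) - eta * gam * gw - Lf / 2 * (eta * gam) ^+ 2 * W <= fx'y ->
  fx'y + eta * lam * hv - Lf / 2 * (eta * lam) ^+ 2 * V <= fx'y' ->
  (Fx' - fx'y) * mu + V / 2 - Lf ^+ 2 * (eta * gam) ^+ 2 * W - e <= hv ->
  Fx' + A * (Fx' - fx'y') + gam * eta / 4 * (W + 2 * Lf ^+ 2 / mu * dl)
    + 8 * gam * Lf ^+ 2 * eta * (gam ^+ 2 * W + lam ^+ 2 * V)
  <= Fx + A * dl + gam * eta * r + A * (eta * lam) * e.
Proof.
move=> mu_gt0 Lf_gt0 lam0 gam0 eta01 hr hg hl AE W0 V0 N0 dl0 Ndl iG iy F1 f1 f2 ih.
have /andP[eta0 eta1] := eta01.
have budget := step_size_budget mu_gt0 Lf_gt0 lam0 gam0 eta01 hr hg AE.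
have A0 : 0 < A by rewrite AE divr_gt0 ?mulr_gt0 ?exprn_gt0.
have muN : mu != 0 by rewrite gt_eqF.
have lamN : lam != 0 by rewrite gt_eqF.
have el0 : 0 < eta * lam by rewrite mulr_gt0.
have eg0 : 0 < eta * gam by rewrite mulr_gt0.
have rho1 : eta * lam * mu <= 1.
  have rho0 : 0 < lam * mu by rewrite mulr_gt0.
  have : lam * mu <= 1.
    by rewrite -(@ler_pXn2r _ 2) ?nnegrE ?(ltW rho0)// expr1n; lra.
  by rewrite -mulrA => h; rewrite -[leRHS]mulr1 ler_pM// ltW.
(* [Q] is the gap halfway through the step: [x] has moved, [y] has not. *)
set Q := Fx' - fx'y in ih.
have dl' : Fx' - fx'y' <= (1 - eta * lam * mu) * Q - eta * lam / 4 * V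
    + eta * lam * (Lf ^+ 2 * (eta * gam) ^+ 2 * W) + eta * lam * e.
  have h1 := ler_wpM2l (ltW el0) ih.
  have h2 : Lf / 2 * (eta * lam) ^+ 2 * V <= eta * lam / 4 * V.
    apply: ler_wpM2r => //.
    have -> : Lf / 2 * (eta * lam) ^+ 2 = eta * lam / 4 * (2 * (eta * lam * Lf)) by field.
    by rewrite ler_piMr// divr_ge0// ltW.
  by move: h1 h2 f2; clear -R; rewrite /Q; lra.
have hQ : Q <= dl + eta * gam * (gw - GW) + Lf * (2 + Lf / mu) / 2 * (eta * gam) ^+ 2 * W.
  have -> : Lf * (2 + Lf / mu) / 2 * (eta * gam) ^+ 2 * W =
     Lf * (1 + Lf / mu) / 2 * (eta * gam) ^+ 2 * W + Lf / 2 * (eta * gam) ^+ 2 * W by field.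
  by move: F1 f1; clear -R; rewrite /Q; lra.
clearbody Q.
set a1 := Lf * (1 + Lf / mu) / 2 in budget F1.
set a2 := Lf * (2 + Lf / mu) / 2 in budget hQ.
have a20 : 0 <= a2.
  by rewrite /a2 divr_ge0// mulr_ge0 ?addr_ge0 ?divr_ge0// ltW.
(* [U] bounds the growth of [A] times the gap under the [x] step. Being nonnegative, it loses the
   contraction factor harmlessly, while the old gap keeps it. *)
pose U := eta * gam * (A ^+ 2 / 12 * W + 3 * N) + A * (a2 * (eta * gam) ^+ 2 * W).
have AQ : A * Q <= A * dl + U.
  have h1 := ler_wpM2l (ltW A0) hQ; have h2 := ler_wpM2l (ltW eg0) iy.
  by move: h1 h2; rewrite /U; clearbody a2; clear -R; lra.
have U0 : 0 <= U.
  have s1 : 0 <= A ^+ 2 / 12 * W by rewrite mulr_ge0// divr_ge0// sqr_ge0.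
  have s2 : 0 <= a2 * (eta * gam) ^+ 2 * W by rewrite mulr_ge0// mulr_ge0// sqr_ge0.
  rewrite /U addr_ge0//; last by rewrite mulr_ge0// ltW.
  by rewrite mulr_ge0 ?(ltW eg0)// addr_ge0// mulr_ge0.
have AQ' : A * ((1 - eta * lam * mu) * Q) <= A * dl - A * (eta * lam * mu) * dl + U.
  have o0 : 0 <= 1 - eta * lam * mu by rewrite subr_ge0.
  have h1 := ler_wpM2l o0 AQ.
  have h2 : (1 - eta * lam * mu) * U <= U.
    by rewrite ler_piMl// gerBl mulr_ge0 ?(ltW el0) ?(ltW mu_gt0).
  by move: h1 h2; clearbody U; clear -R; lra.
pose z := gam * eta * (Lf ^+ 2 / mu) * dl.
have Adl : A * (eta * lam * mu) * dl = 9 * z.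
  by rewrite /z AE; field; rewrite muN lamN.
have gN : gam * eta * N <= 2 * z.
  have -> : 2 * z = gam * eta * (2 * Lf ^+ 2 / mu * dl) by rewrite /z; field.
  by rewrite ler_wpM2l// mulr_ge0// ltW.
have Wc := ler_wpM2r W0 (ler_wpM2l (ltW eg0) budget).
(* After division this reads [8 lam^2 <= 9 / (4 mu^2)], exactly the condition [hr]. *)
have Vc : 8 * gam * Lf ^+ 2 * eta * (lam ^+ 2 * V) <= A * (eta * lam / 4 * V).
  have -> : A * (eta * lam / 4 * V) = 8 * gam * Lf ^+ 2 * eta * (9 / (32 * mu ^+ 2) * V).
    by rewrite AE; field; rewrite muN lamN.
  have c0 : 0 <= 8 * gam * Lf ^+ 2 * eta.
    by rewrite mulr_ge0 ?(ltW eta0)// mulr_ge0 ?sqr_ge0// mulr_ge0// ltW.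
  rewrite ler_wpM2l// ler_wpM2r//.
  by rewrite ler_pdivlMr ?mulr_gt0 ?exprn_gt0//; move: hr; rewrite exprMn; clear -R; lra.
have z0 : 0 <= z.
  by rewrite /z mulr_ge0// mulr_ge0 ?divr_ge0 ?sqr_ge0 ?(ltW mu_gt0)// mulr_ge0// ltW.
have h1 := ler_wpM2l (ltW A0) dl'; have h2 := ler_wpM2l (ltW eg0) iG.
have -> : gam * eta / 4 * (W + 2 * Lf ^+ 2 / mu * dl) = gam * eta / 4 * W + z / 2.
  by rewrite /z; field.
move: h1 h2 F1 AQ' Wc Vc gN z0; rewrite Adl /U; clearbody a1 a2 z; clear -R.
lra.
Qed.

(** The contraction by [al = c eta^2] gains [gam c eta E]. The growth of the weight from
    [gam / etaP] to [gam / eta] uses up at most the share [c - q]; the share [q] stays available for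
    paying the errors of the descent step. *)
Lemma momentum_scalar (R : realType) (Lf gam eta etaP c q sg E C al : R) :
  0 < gam -> 0 < eta -> 0 <= E -> 0 <= C -> 0 <= al <= 1 -> al = c * eta ^+ 2 ->
  eta^-1 - etaP^-1 <= (c - q) * eta ->
  gam / eta * ((1 - al) ^+ 2 * E + 2 * al ^+ 2 * sg + 2 * (1 - al) ^+ 2 * (2 * Lf ^+ 2 * eta ^+
    2 * C))
   + gam * q * eta * E
  <= gam / etaP * E + 2 * gam * c ^+ 2 * eta ^+ 3 * sg + 4 * gam * Lf ^+ 2 * eta * C.
Proof.
move=> gam0 eta0 E0 C0 /andP[al0 al1] alE hi.
have etaN : eta != 0 by rewrite gt_eqF.
have a1 : (1 - al) ^+ 2 <= 1 - al by rewrite expr2 ler_piMr; lra.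
have a2 : (1 - al) ^+ 2 <= 1 by lra.
have ge0 : 0 <= gam / eta by rewrite divr_ge0// ltW.
have C1 : 0 <= 4 * gam * Lf ^+ 2 * eta * C.
  by rewrite mulr_ge0// mulr_ge0 ?(ltW eta0)// mulr_ge0 ?sqr_ge0// mulr_ge0// ltW.
have h1 : gam / eta * ((1 - al) ^+ 2 * E) <= gam / eta * ((1 - al) * E).
  by rewrite ler_wpM2l// ler_wpM2r.
have h2 : gam / eta * (2 * (1 - al) ^+ 2 * (2 * Lf ^+ 2 * eta ^+ 2 * C)) <= 4 * gam * Lf ^+ 2 *
  eta * C.
  have -> : gam / eta * (2 * (1 - al) ^+ 2 * (2 * Lf ^+ 2 * eta ^+ 2 * C)) =
    4 * gam * Lf ^+ 2 * eta * C * (1 - al) ^+ 2 by field.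
  by rewrite ler_piMr.
have h3 : gam / eta * (2 * al ^+ 2 * sg) = 2 * gam * c ^+ 2 * eta ^+ 3 * sg.
  by rewrite alE; field.
have h4 : gam / eta * ((1 - al) * E) = gam * E * eta^-1 - gam * E * (c * eta).
  by rewrite alE; field.
have h5 : gam * E * (eta^-1 - etaP^-1) <= gam * E * ((c - q) * eta).
  by rewrite ler_wpM2l// mulr_ge0// ltW.
move: h1 h2 h4 h5; rewrite !(mulrDr (gam / eta)) h3.
set u := gam / eta * _; set v := gam / eta * (_ * (2 * _ * _ * C)).
set u' := gam / eta * _; set i := eta^-1; set j := etaP^-1.
clearbody u v u' i j; clear -R; lra.
Qed.

Section dotp_bounds.
Context {R : realType} (n : nat).
Implicit Types (u v w : 'rV[R]_n).

(** Polarization of [dotp u w] with [|u - w|^2 <= 2 |u - v|^2 + 2 |v - w|^2]; here the square of [u]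
    is dropped, in [dotp_ge] it is kept for the PL inequality. *)
Lemma dotpN_le u v w :
  - dotp u w <= dotp (u - v) (u - v) + dotp (v - w) (v - w) - dotp w w / 2.
Proof.
have h1 := dotp_ge0 ((u - v) - (v - w)); have h2 := dotp_ge0 u.
move: h1 h2; rewrite !(dotpDl, dotpDr, dotpNl, dotpNr).
by rewrite (dotpC w u) (dotpC v u) (dotpC w v); lra.
Qed.

Lemma dotp_ge u v w :
  dotp u u / 2 + dotp w w / 2 - dotp (u - v) (u - v) - dotp (v - w) (v - w) <= dotp u w.
Proof.
have := dotp_ge0 ((u - v) - (v - w)).
rewrite !(dotpDl, dotpDr, dotpNl, dotpNr).
by rewrite (dotpC w u) (dotpC v u) (dotpC w v); lra.
Qed.

(** Expand the square of [a w - 6 (v - u)] and divide by 12. The weight 6 balances the budget of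
    [|w|^2] against that of the gap. *)
Lemma dotp_young (a : R) u v w :
  a * (dotp v w - dotp u w) <= a ^+ 2 / 12 * dotp w w + 3 * dotp (u - v) (u - v).
Proof.
have := dotp_ge0 (a *: w - 6 *: (v - u)).
rewrite !(dotpDl, dotpDr, dotpZl, dotpZr, dotpNl, dotpNr).
by rewrite (dotpC w u) (dotpC v u) (dotpC w v); lra.
Qed.

End dotp_bounds.

(** * Smoothness of the value function and the gradient gap *)

Section max_function.
Context {R : realType} (d p : nat).
Variables (f : 'rV[R]_d -> 'rV[R]_p -> R) (F : 'rV[R]_d -> R) (mu Lf : R).
Hypothesis diff_fx : forall x y, differentiable (fun x' => f x' y) x.
Hypothesis diff_fy : forall x y, differentiable (fun y' => f x y') y.
Hypothesis F_max : forall x, exists ys, (forall y, f x y <= f x ys) /\ F x = f x ys.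
Hypothesis mu_gt0 : 0 < mu.
Hypothesis Lf_gt0 : 0 < Lf.
Hypothesis PL : forall x y, 2 * mu * (F x - f x y) <= enorm (grady f x y) ^+ 2.
Hypothesis lip_xx : forall x x' y, enorm (gradx f x y - gradx f x' y) <= Lf * enorm (x - x').
Hypothesis lip_xy : forall x y y', enorm (gradx f x y - gradx f x y') <= Lf * enorm (y - y').
Hypothesis lip_yx : forall x x' y, enorm (grady f x y - grady f x' y) <= Lf * enorm (x - x').
Hypothesis lip_yy : forall x y y', enorm (grady f x y - grady f x y') <= Lf * enorm (y - y').

Lemma max_ge x y : f x y <= F x.
Proof. by have [ys [ysmax ->]] := F_max x. Qed.

Lemma quad_ub_x x y u : f (x + u) y <= f x y + dotp (gradx f x y) u + Lf / 2 * dotp u u.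
Proof. by apply: (@grad_lipschitz_ub _ _ _ (fun x' => f x' y)) => // z z'; exact: lip_xx. Qed.

Lemma quad_lb_x x y u : f x y + dotp (gradx f x y) u - Lf / 2 * dotp u u <= f (x + u) y.
Proof. by apply: (@grad_lipschitz_lb _ _ _ (fun x' => f x' y)) => // z z'; exact: lip_xx. Qed.

Lemma quad_lb_y x y u : f x y + dotp (grady f x y) u - Lf / 2 * dotp u u <= f x (y + u).
Proof. by apply: (@grad_lipschitz_lb _ _ _ (f x)) => // z z'; exact: lip_yy. Qed.

(** A gradient step of length [1 / Lf] from [ys] would raise [f x] by at least
    [|grad_y f|^2 / (2 Lf)], which maximality forbids. *)
Lemma grady_argmax x ys : F x = f x ys -> grady f x ys = 0.
Proof.
move=> Fx; apply/eqP; rewrite -dotp_eq0.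
have := quad_lb_y x ys (Lf^-1 *: grady f x ys); rewrite dotpZr dotpZl dotpZr.
have := max_ge x (ys + Lf^-1 *: grady f x ys); rewrite Fx.
set g := dotp _ _ => h1 h2; have : Lf^-1 * g <= 0.
  by have -> : Lf^-1 * g = 2 * (Lf^-1 * g - Lf / 2 * (Lf^-1 * (Lf^-1 * g))); [field; rewrite
    gt_eqF|lra].
by rewrite pmulr_rle0 ?invr_gt0// eq_le dotp_ge0 andbT.
Qed.

(* The PL inequality at the old maximizer replaces the Lipschitz continuity of
   the argmax: [F] gets its quadratic upper bound without quadratic growth. *)
Lemma gap_argmax x ys u : F x = f x ys ->
  F (x + u) - f (x + u) ys <= Lf ^+ 2 / (2 * mu) * dotp u u.
Proof.
move=> Fx; have h2 := PL (x + u) ys.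
have := lip_yx (x + u) x ys; rewrite (grady_argmax Fx) subr0 (addrC x u) addrK (addrC u x) => h1.
have h4 : enorm (grady f (x + u) ys) ^+ 2 <= Lf ^+ 2 * dotp u u.
  by rewrite -enorm_sqr -exprMn ler_pXn2r ?nnegrE ?enorm_ge0 ?mulr_ge0 ?enorm_ge0 // ltW.
rewrite mulrAC ler_pdivlMr ?mulr_gt0//; apply: le_trans h4; apply: le_trans h2.
by rewrite mulrC.
Qed.

Lemma quad_ub_max x ys u : F x = f x ys ->
  F (x + u) <= F x + dotp (gradx f x ys) u + Lf * (1 + Lf / mu) / 2 * dotp u u.
Proof.
move=> Fx; have h3 := quad_ub_x x ys u; have h5 := gap_argmax u Fx.
have -> : Lf * (1 + Lf / mu) / 2 * dotp u u = Lf / 2 * dotp u u + Lf ^+ 2 / (2 * mu) * dotp u u.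
  by field; rewrite gt_eqF.
rewrite Fx; lra.
Qed.

Lemma quad_lb_max x ys u : F x = f x ys ->
  F x + dotp (gradx f x ys) u - Lf / 2 * dotp u u <= F (x + u).
Proof.
by move=> ->; apply: le_trans (max_ge _ ys); exact: quad_lb_x.
Qed.

Lemma diff_max x ys : F x = f x ys ->
  differentiable F x /\ gradient F x = gradx f x ys.
Proof.
move=> Fx; apply: (@differentiable_quad _ _ _ _ _ (Lf * (1 + Lf / mu) / 2)) => u.
have := quad_ub_max u Fx; have := quad_lb_max u Fx.
have : Lf / 2 * dotp u u <= Lf * (1 + Lf / mu) / 2 * dotp u u.
  rewrite ler_wpM2r ?dotp_ge0// ler_wpM2r// ler_peMr ?(ltW Lf_gt0)// lerDl.
  by rewrite divr_ge0// ltW.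
by rewrite ler_norml; lra.
Qed.

Lemma differentiable_max x : differentiable F x.
Proof. by have [ys [_ /diff_max[]]] := F_max x. Qed.

Lemma max_descent x u :
  F (x + u) <= F x + dotp (gradient F x) u + Lf * (1 + Lf / mu) / 2 * dotp u u.
Proof.
have [ys [_ Fx]] := F_max x; rewrite (diff_max Fx).2.
exact: quad_ub_max.
Qed.

(** The function [F - f(., y)] is nonnegative and has a quadratic upper model with constant [L2], so
    a step of length [1 / L2] against its gradient bounds that gradient by its value. The constant
    is too large for the theorem, but it is finite and starts the iteration below. *)
Lemma grad_gap_crude x y :
  enorm (gradient F x - gradx f x y) ^+ 2 <= 2 * (Lf * (2 + Lf / mu)) * (F x - f x y).
Proof.
set G := gradient F x - gradx f x y; set L2 := Lf * (2 + Lf / mu).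
have L20 : 0 < L2 by rewrite mulr_gt0// ltr_wpDr// divr_ge0// ltW.
have := max_descent x (- L2^-1 *: G); have := quad_lb_x x y (- L2^-1 *: G).
have := max_ge (x + (- L2^-1 *: G)) y; rewrite !(dotpZl, dotpZr) enorm_sqr.
have -> : dotp G G = dotp (gradient F x) G - dotp (gradx f x y) G by rewrite {1}/G dotpDl dotpNl.
set a := dotp (gradient F x) G; set b := dotp (gradx f x y) G => h1 h2 h3.
have : 0 <= F x - f x y + - L2^-1 * (a - b) + (Lf * (1 + Lf / mu) / 2 + Lf / 2) * (- L2^-1 * (-
  L2^-1 * (a - b))).
  move: h1 h2 h3; set i := - L2^-1; set k := Lf * _ / 2; set Fu := F (x + _); set fu := f (x +
    _) _.
  set Fx := F x; set fx := f x y; clearbody i k Fu fu Fx fx a b; lra.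
have -> : Lf * (1 + Lf / mu) / 2 + Lf / 2 = L2 / 2 by rewrite /L2; field; rewrite gt_eqF.
have -> : F x - f x y + - L2^-1 * (a - b) + L2 / 2 * (- L2^-1 * (- L2^-1 * (a - b))) =
  (2 * L2 * (F x - f x y) - (a - b)) / (2 * L2) by field; rewrite gt_eqF.
have i0 : 0 < (2 * L2)^-1 by rewrite invr_gt0 mulr_gt0.
by rewrite (pmulr_lge0 _ i0) subr_ge0.
Qed.

(* One gradient-ascent step of length [s] shortens [sqrt (F x - f x y)] at least
   in proportion to the distance travelled, so a bound with constant [K]
   improves to one with constant [M + q (K - M)], [q < 1]. *)
Lemma grad_gap_improve x (s M K q : R) (th := 1 - Lf * s / 2) :
  0 < s -> 2 * mu * s <= 1 -> Lf * s <= 1 ->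
  M * th * Num.sqrt (mu / 2) = Lf -> M <= K -> 0 <= q -> q ^+ 2 = 1 - 2 * mu * s * th ->
  (forall y, enorm (gradient F x - gradx f x y) <= K * Num.sqrt (F x - f x y)) ->
  forall y, enorm (gradient F x - gradx f x y) <=
            (M + q * (K - M)) * Num.sqrt (F x - f x y).
Proof.
move=> s0 s1 s2 ME MK q0 qE HK y.
have th0 : 0 < th by rewrite /th; lra.
have rm : 0 < Num.sqrt (mu / 2) by rewrite sqrtr_gt0 divr_gt0.
have rmE : Num.sqrt (mu / 2) ^+ 2 = mu / 2 by rewrite sqr_sqrtr// divr_ge0// ltW.
have M0 : 0 < M.
  by have := Lf_gt0; rewrite -ME -mulrA pmulr_lgt0// mulr_gt0.
set g := grady f x y; pose y' := y + s *: g.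
set a := Num.sqrt (F x - f x y); set b := Num.sqrt (F x - f x y').
set r := Num.sqrt (mu / 2) in ME rm rmE.
have a0 : 0 <= a by exact: sqrtr_ge0.
have b0 : 0 <= b by exact: sqrtr_ge0.
have aE : a ^+ 2 = F x - f x y by rewrite sqr_sqrtr// subr_ge0 max_ge.
have bE : b ^+ 2 = F x - f x y' by rewrite sqr_sqrtr// subr_ge0 max_ge.
have G0 := enorm_ge0 g; set G := enorm g in G0.
have ab : b ^+ 2 <= a ^+ 2 - s * th * G ^+ 2.
  have := quad_lb_y x y (s *: g); rewrite -/y' -/g !(dotpZl, dotpZr) -enorm_sqr -/G aE bE /th;
    lra.
have Ga : 4 * r ^+ 2 * a ^+ 2 <= G ^+ 2.
  by rewrite rmE aE; have := PL x y; rewrite -/g -/G; lra.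
have Gra : 2 * r * a <= G.
  rewrite -(@ler_pXn2r _ 2) ?nnegrE ?mulr_ge0 ?(ltW rm)//.
  by rewrite !exprMn; move: Ga; lra.
(* Linear convergence of gradient ascent under the PL inequality: the step gains [s th G^2], and
   [G >= 2 r a]. *)
have bq : b <= q * a.
  rewrite -(@ler_pXn2r _ 2) ?nnegrE ?mulr_ge0// exprMn qE.
  have sth : 0 <= s * th by rewrite mulr_ge0// ltW.
  have := ler_wpM2l sth Ga; rewrite rmE; move: ab; lra.
(* Divide [a^2 - b^2 >= s th G^2] by [a + b <= 2 a <= G / r]. Thus the distance [s G] travelled is
   charged to the decrease of the square root of the gap. *)
have step : s * th * r * G <= a - b.
  have bla : b <= a.
    rewrite -(@ler_pXn2r _ 2) ?nnegrE//; apply: le_trans ab _.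
    by rewrite gerBl !mulr_ge0 ?sqr_ge0 ?(ltW th0) ?(ltW s0).
  have [az|az] := eqVneq a 0.
    have bz : b = 0 by apply/eqP; rewrite eq_le b0 andbT -az.
    move: ab; rewrite az bz expr0n/= sub0r subrr => h.
    have : s * th * G ^+ 2 <= 0 by lra.
    rewrite pmulr_rle0 ?mulr_gt0// => Gz.
    have -> : G = 0 by apply/eqP; rewrite -sqrf_eq0 eq_le Gz sqr_ge0.
    by rewrite mulr0.
  have ap : 0 < a by rewrite lt_def az.
  have h1 : s * th * (2 * r * a) * G <= s * th * G * G.
    by rewrite ler_wpM2r// ler_wpM2l// mulr_ge0// ltW.
  have h2 : (a - b) * (a + b) <= (a - b) * (2 * a) by rewrite ler_wpM2l ?subr_ge0//; lra.
  rewrite -(@ler_pM2r _ (2 * a)) ?mulr_gt0//; move: h1 h2 ab; lra.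
have c1 : enorm (gradient F x - gradx f x y) <= K * b + Lf * (s * G).
  apply: (@le_trans _ _ (enorm (gradient F x - gradx f x y') + enorm (gradx f x y' - gradx f x
    y))).
    by rewrite -{1}(subrK (gradx f x y') (gradient F x)) -addrA enormD.
  apply: lerD; first exact: HK.
  apply: le_trans (lip_xy _ _ _) _; rewrite ler_wpM2l ?(ltW Lf_gt0)//.
  by rewrite /y' (addrC y) addrK enormZ gtr0_norm.
apply: (le_trans c1).
have h1 : Lf * (s * G) <= M * (a - b).
  rewrite -ME; have := ler_wpM2l (ltW M0) step; lra.
have h2 : (K - M) * b <= (K - M) * (q * a) by rewrite ler_wpM2l ?subr_ge0.
by move: h1 h2; lra.
Qed.

Lemma grad_gap_iter x (s M K q : R) (th := 1 - Lf * s / 2) n :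
  0 < s -> 2 * mu * s <= 1 -> Lf * s <= 1 ->
  M * th * Num.sqrt (mu / 2) = Lf -> M <= K -> 0 <= q -> q ^+ 2 = 1 - 2 * mu * s * th ->
  (forall y, enorm (gradient F x - gradx f x y) <= K * Num.sqrt (F x - f x y)) ->
  forall y, enorm (gradient F x - gradx f x y) <=
            (M + q ^+ n * (K - M)) * Num.sqrt (F x - f x y).
Proof.
move=> s0 s1 s2 ME MK q0 qE HK; elim: n => [|n IH] y.
  by rewrite expr0 mul1r (addrC M) subrK; exact: HK.
apply: le_trans (grad_gap_improve s0 s1 s2 ME _ q0 qE IH y) _.
  by rewrite lerDl mulr_ge0 ?exprn_ge0// subr_ge0.
by rewrite (addrC M (q ^+ n * _)) addrK exprS mulrA.
Qed.

Lemma grad_gap x y :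
  enorm (gradient F x - gradx f x y) ^+ 2 <= 2 * Lf ^+ 2 / mu * (F x - f x y).
Proof.
set c := enorm _; set a := Num.sqrt (F x - f x y); set r := Num.sqrt (mu / 2).
have aE : a ^+ 2 = F x - f x y by rewrite sqr_sqrtr// subr_ge0 max_ge.
have r0 : 0 < r by rewrite sqrtr_gt0 divr_gt0.
have rE : r ^+ 2 = mu / 2 by rewrite sqr_sqrtr// divr_ge0// ltW.
have c0 : 0 <= c by exact: enorm_ge0.
have a0 : 0 <= a by exact: sqrtr_ge0.
(* For a fixed step [s], letting the number of iterations grow turns the constant into
   [M = Lf / (th r)]. *)
have key (s : R) : 0 < s -> 2 * mu * s <= 1 -> Lf * s <= 1 ->
    c * (1 - Lf * s / 2) * r <= Lf * a.
  move=> s0 s1 s2; set th := 1 - _.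
  have th0 : 0 < th by rewrite /th; lra.
  have th1 : th < 1 by rewrite /th; have := mulr_gt0 Lf_gt0 s0; lra.
  pose M := Lf / (th * r).
  have ME : M * th * r = Lf by rewrite /M -mulrA divfK// gt_eqF// mulr_gt0.
  (* The maximum ensures [M <= K], so that the iteration starts above its fixed point. *)
  pose K := Num.max M (Num.sqrt (2 * (Lf * (2 + Lf / mu)))).
  have MK : M <= K by rewrite le_max lexx.
  have HK z : enorm (gradient F x - gradx f x z) <= K * Num.sqrt (F x - f x z).
    apply: (@le_trans _ _ (Num.sqrt (2 * (Lf * (2 + Lf / mu))) * Num.sqrt (F x - f x z))).
      have L20 : 0 <= Lf * (2 + Lf / mu) by rewrite mulr_ge0 ?addr_ge0 ?divr_ge0// ltW.
      rewrite -sqrtrM; last by rewrite mulr_ge0.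
      have h := ler_wsqrtr (grad_gap_crude x z).
      by apply: le_trans h; rewrite sqrtr_sqr ler_norm.
    rewrite ler_wpM2r ?sqrtr_ge0// le_max lexx orbT//.
  have s3 : 2 * mu * s * th <= 1.
    by have : 2 * mu * s * th <= 1 * 1; [rewrite ler_pM// ?mulr_ge0// ltW|rewrite mulr1].
  have q20 : 0 <= 1 - 2 * mu * s * th by lra.
  pose q := Num.sqrt (1 - 2 * mu * s * th).
  have qE : q ^+ 2 = 1 - 2 * mu * s * th by rewrite sqr_sqrtr.
  have q0 : 0 <= q by exact: sqrtr_ge0.
  have q1 : `|q| < 1.
    rewrite ger0_norm// -(@ltr_pXn2r _ 2) ?nnegrE// expr1n qE gtrBl.
    by rewrite !mulr_gt0.
  have le n := grad_gap_iter n s0 s1 s2 ME MK q0 qE HK y.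
  have cM : c <= M * a.
    rewrite leNgt; apply/negP => Mc; have e0 : 0 < c - M * a by rewrite subr_gt0.
    have := cvg_geometric ((K - M) * a) q1 => /cvgrPdist_lt/(_ _ e0) h.
    have [n _] := h; move=> /(_ n (leqnn _)) /=; rewrite sub0r normrN => hn.
    have := ltr_normlW hn; have := le n; rewrite -/c -/a.
    lra.
  have := ler_wpM2r (ltW (mulr_gt0 th0 r0)) cM.
  by rewrite -[X in _ <= X * a]ME; clearbody M th; lra.
(* Now [s] tends to 0 and [th] to 1. If the claim failed by [D], then [key] would give [D <= s E],
   against the choice [s (E + 1) <= D]. *)
have cr : c * r <= Lf * a.
  rewrite leNgt; apply/negP => h; set D := c * r - Lf * a.
  have D0 : 0 < D by rewrite subr_gt0.
  set E := Lf / 2 * (c * r).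
  have E0 : 0 <= E by rewrite mulr_ge0 ?divr_ge0 ?mulr_ge0// ltW.
  have E1 : 0 < E + 1 by rewrite ltr_wpDl.
  pose s := Num.min (D / (E + 1)) (Num.min (2 * mu)^-1 Lf^-1).
  have s0 : 0 < s.
    rewrite !lt_min; apply/and3P; split; first by rewrite divr_gt0.
      by rewrite invr_gt0 mulr_gt0.
    by rewrite invr_gt0.
  have s1 : 2 * mu * s <= 1.
    by rewrite mulrC -ler_pdivlMr ?mulr_gt0// mul1r !ge_min lexx orbT.
  have s2 : Lf * s <= 1 by rewrite mulrC -ler_pdivlMr// mul1r !ge_min lexx !orbT.
  have s3 : s * (E + 1) <= D by rewrite -ler_pdivlMr// ge_min lexx.
  have := key s s0 s1 s2; move: s3 s0; clearbody s; rewrite /D /E.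
  lra.
have : (c * r) ^+ 2 <= (Lf * a) ^+ 2.
  by rewrite ler_pXn2r ?nnegrE ?mulr_ge0// ltW.
rewrite !exprMn rE aE => h.
have -> : 2 * Lf ^+ 2 / mu * (F x - f x y) = (Lf ^+ 2 * (F x - f x y)) / (mu / 2) by field;
  rewrite gt_eqF.
by rewrite ler_pdivlMr ?divr_gt0.
Qed.

(** Insert [gradx f x' ys], with [ys] a maximizer at [x]: [grad_gap] at [x'] and [gap_argmax]
    combine to the constant [Lf^2 / mu]. The continuity of [grad F] obtained here makes
    [|grad F (x_t)|] measurable. *)
Lemma gradient_max_lipschitz : grad_lipschitz (Lf * (1 + Lf / mu)) F.
Proof.
move=> x' x; have [ys [_ Fx]] := F_max x; rewrite (diff_max Fx).2.
have h1 := lip_xx x' x ys.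
have h2 : enorm (gradient F x' - gradx f x' ys) <= Lf * (Lf / mu) * enorm (x' - x).
  rewrite -(@ler_pXn2r _ 2) ?nnegrE ?enorm_ge0//; last first.
    by rewrite mulr_ge0 ?enorm_ge0// mulr_ge0 ?divr_ge0 ?(ltW Lf_gt0) ?(ltW mu_gt0).
  apply: le_trans (grad_gap x' ys) _; rewrite exprMn enorm_sqr.
  have := gap_argmax (x' - x) Fx; rewrite (addrC x) subrK => h.
  have c0 : 0 <= 2 * Lf ^+ 2 / mu by rewrite divr_ge0 ?(ltW mu_gt0)// mulr_ge0// sqr_ge0.
  apply: le_trans (ler_wpM2l c0 h) _; rewrite le_eqVlt; apply/orP; left; apply/eqP.
  by field; rewrite gt_eqF.
have := enormD (gradient F x' - gradx f x' ys) (gradx f x' ys - gradx f x ys).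
rewrite addrA subrK => h3; apply: le_trans h3 _.
by rewrite mulrDr mulr1 mulrDl [leRHS]addrC lerD.
Qed.

Lemma descent_step (lam gam eta A : R) x y w v
    (x' := x - (eta * gam) *: w) (y' := y + (eta * lam) *: v) :
  0 < lam -> 0 < gam -> 0 < eta <= 1 ->
  32 * (lam * mu) ^+ 2 <= 9 -> 8 * gam * (Lf * (2 + Lf / mu)) <= lam * mu ->
  2 * (eta * lam * Lf) <= 1 ->
  A = 9 * gam * Lf ^+ 2 / (lam * mu ^+ 2) ->
  F x' + A * (F x' - f x' y')
    + gam * eta / 4 * (dotp w w + 2 * Lf ^+ 2 / mu * (F x - f x y))
    + 8 * gam * Lf ^+ 2 * eta * (gam ^+ 2 * dotp w w + lam ^+ 2 * dotp v v)
  <= F x + A * (F x - f x y) + gam * eta * enorm (gradx f x y - w) ^+ 2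
     + A * (eta * lam) * enorm (grady f x y - v) ^+ 2.
Proof.
move=> lam0 gam0 eta01 hr hg hl AE; have /andP[eta0 eta1] := eta01.
have eg0 : 0 < eta * gam by rewrite mulr_gt0.
set G := gradient F x; set g := gradx f x y; set h := grady f x y.
pose W := dotp w w; pose V := dotp v v; pose dl := F x - f x y.
pose N := dotp (G - g) (G - g).
pose e := dotp (h - v) (h - v); pose r := dotp (g - w) (g - w).
have W0 : 0 <= W := dotp_ge0 _; have V0 : 0 <= V := dotp_ge0 _.
have N0 : 0 <= N := dotp_ge0 _; have e0 : 0 <= e := dotp_ge0 _.
have dl0 : 0 <= dl by rewrite subr_ge0; exact: max_ge.
have Ndl : N <= 2 * Lf ^+ 2 / mu * dl.
  by rewrite /N -enorm_sqr; apply: grad_gap.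
have F1 : F x' <= F x - eta * gam * dotp G w
    + Lf * (1 + Lf / mu) / 2 * (eta * gam) ^+ 2 * W.
  have := max_descent x (- ((eta * gam) *: w)).
  rewrite -/x' -/G dotpNr dotpNl dotpNr opprK !(dotpZl, dotpZr) -/W.
  by rewrite expr2; lra.
have f1 : f x y - eta * gam * dotp g w - Lf / 2 * (eta * gam) ^+ 2 * W <= f x' y.
  have := quad_lb_x x y (- ((eta * gam) *: w)).
  rewrite -/x' -/g dotpNr dotpNl dotpNr opprK !(dotpZl, dotpZr) -/W.
  by rewrite expr2; lra.
set h' := grady f x' y.
have f2 : f x' y + eta * lam * dotp h' v - Lf / 2 * (eta * lam) ^+ 2 * V <= f x' y'.
  have := quad_lb_y x' y ((eta * lam) *: v).
  rewrite -/y' -/h' !(dotpZl, dotpZr) -/V.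
  by rewrite expr2; lra.
pose Q := F x' - f x' y.
have PLQ : 2 * mu * Q <= dotp h' h' by rewrite -enorm_sqr; exact: PL.
have hh : dotp (h' - h) (h' - h) <= Lf ^+ 2 * (eta * gam) ^+ 2 * W.
  rewrite -enorm_sqr /W -enorm_sqr -!exprMn ler_pXn2r ?nnegrE ?mulr_ge0 ?enorm_ge0 ?(ltW
    Lf_gt0) ?(ltW eta0) ?(ltW gam0)//.
  have := lip_yx x' x y; rewrite -/h' -/h /x' (addrC x) addrK enormN enormZ.
  by rewrite gtr0_norm// mulrA.
(* The PL inequality is used at the new [x'], whereas the error of [v] refers to the old [x]; the
   drift [h' - h] is bounded by [hh]. *)
have ih : Q * mu + V / 2 - Lf ^+ 2 * (eta * gam) ^+ 2 * W - e <= dotp h' v.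
  by apply: le_trans (dotp_ge h' h v); rewrite -/V -/e; move: hh PLQ; lra.
rewrite !enorm_sqr -/g -/h -/e -/r -/W -/V -/dl.
apply: (descent_scalar mu_gt0 Lf_gt0 lam0 gam0 eta01 hr hg hl AE W0 V0 N0 dl0 Ndl
  (dotpN_le G g w) (dotp_young A G g w) F1 _ f2 ih).
by have -> : F x - dl = f x y; [rewrite /dl opprB addrC subrK|exact: f1].
Qed.

(** [momentum_scalar] is applied with [q = 9 Lf^2 / mu^2] for [v] and [q = 9 / 4] for [w]. Each
    application leaves [4 gam Lf^2 eta] times the squared displacement; together they match the term
    with factor 8 in [descent_step]. *)
Lemma lyapunov_step (lam gam eta etaP A c1 c2 al be sg : R) x y w v
    (x' := x - (eta * gam) *: w) (y' := y + (eta * lam) *: v)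
    (E := enorm (grady f x y - v) ^+ 2) (r := enorm (gradx f x y - w) ^+ 2)
    (C := 2 * Lf ^+ 2 * eta ^+ 2 * (gam ^+ 2 * dotp w w + lam ^+ 2 * dotp v v)) :
  0 < lam -> 0 < gam -> 0 < eta <= 1 ->
  32 * (lam * mu) ^+ 2 <= 9 -> 8 * gam * (Lf * (2 + Lf / mu)) <= lam * mu ->
  2 * (eta * lam * Lf) <= 1 ->
  A = 9 * gam * Lf ^+ 2 / (lam * mu ^+ 2) ->
  0 <= al <= 1 -> al = c1 * eta ^+ 2 -> 0 <= be <= 1 -> be = c2 * eta ^+ 2 ->
  eta^-1 - etaP^-1 <= (c1 - 9 * Lf ^+ 2 / mu ^+ 2) * eta ->
  eta^-1 - etaP^-1 <= (c2 - 9 / 4) * eta ->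
  F x' + A * (F x' - f x' y')
    + gam / eta * (((1 - al) ^+ 2 * E + 2 * al ^+ 2 * sg + 2 * (1 - al) ^+ 2 * C)
                 + ((1 - be) ^+ 2 * r + 2 * be ^+ 2 * sg + 2 * (1 - be) ^+ 2 * C))
    + gam * eta / 4 * (dotp w w + 2 * Lf ^+ 2 / mu * (F x - f x y) + r)
  <= F x + A * (F x - f x y) + gam / etaP * (E + r)
     + 2 * gam * (c1 ^+ 2 + c2 ^+ 2) * eta ^+ 3 * sg.
Proof.
move=> lam0 gam0 eta01 hr hg hl AE al01 alE be01 beE hi1 hi2.
have /andP[eta0 eta1] := eta01.
have D0 : 0 <= gam ^+ 2 * dotp w w + lam ^+ 2 * dotp v v.
  by rewrite addr_ge0// mulr_ge0 ?sqr_ge0 ?dotp_ge0.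
have E0 : 0 <= E by rewrite sqr_ge0.
have r0 : 0 <= r by rewrite sqr_ge0.
have m1 := momentum_scalar Lf sg gam0 eta0 E0 D0 al01 alE hi1.
have m2 := momentum_scalar Lf sg gam0 eta0 r0 D0 be01 beE hi2.
have ds := descent_step x y w v lam0 gam0 eta01 hr hg hl AE.
have Ae : A * (eta * lam) * E = gam * (9 * Lf ^+ 2 / mu ^+ 2) * eta * E.
  by rewrite AE; field; rewrite !gt_eqF.
move: ds; rewrite -/x' -/y' -/E -/r Ae => ds.
(* The share [9 / 4] pays 1 for the descent step and [1/4] for the metric; the surplus is discarded
   here. *)
have gr : 0 <= gam * eta * r by rewrite mulr_ge0// mulr_ge0// ltW.
rewrite -/C in m1 m2; rewrite [gam / eta * (_ + (_ + _ * C))]mulrDr.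
move: m1 m2; set k1 := gam / eta * _; set k2 := gam / eta * _ => m1 m2.
move: ds m1 m2 gr; set D := _ + lam ^+ 2 * dotp v v.
set dl := F x - f x y.
clearbody k1 k2 D E r dl; lra.
Qed.

End max_function.

(** * Measurability, independence and one-step variance *)

Section caratheodory.
Context {R : realType} (dT : measure_display) (T : measurableType dT) (n : nat).

Definition grid (N : nat) (z : 'rV[R]_n) : 'rV[int]_n :=
  \row_i Num.floor (z ord0 i * N.+1%:R).

Definition ungrid (N : nat) (k : 'rV[int]_n) : 'rV[R]_n :=
  \row_i ((k ord0 i)%:~R / N.+1%:R).

Lemma cvg_grid (z : 'rV[R]_n) : (fun N => ungrid N (grid N z)) @ \oo --> z.
Proof.
have le N : `|z - ungrid N (grid N z)| <= N.+1%:R^-1.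
  rewrite [leLHS]/Num.Def.normr /= mx_normrE; apply: bigmax_le => // -[i j] _ /=.
  rewrite ord1 !mxE; set a := z ord0 j.
  have /andP[h1 h2] := floor_itv (a * N.+1%:R).
  have N0 : (0 : R) < N.+1%:R by rewrite ltr0n.
  have -> : a - (Num.floor (a * N.+1%:R))%:~R / N.+1%:R =
     (a * N.+1%:R - (Num.floor (a * N.+1%:R))%:~R) / N.+1%:R.
    by rewrite mulrBl mulfK// gt_eqF.
  move: h2; rewrite intrD => h2; rewrite normrM normfV (gtr0_norm N0).
  rewrite -[leRHS]mul1r ler_wpM2r ?invr_ge0 ?(ltW N0)// ler_norml.
  by move: h1 h2; set u := a * _; set v := _%:~R; lra.
apply/cvgrPdist_le => e e0; have := @cvg_harmonic R.
move=> /cvgrPdist_le/(_ e e0); apply: filterS => N; rewrite sub0r normrN => h.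
by apply: le_trans (le N) _; apply: le_trans h; rewrite /harmonic ler_norm.
Qed.

(** Rounding [z] to the lattice of mesh [1 / (N + 1)] leaves countably many values, so the composite
    is measurable piece by piece; continuity in the second argument passes to the limit. *)
Lemma measurable_caratheodory (h : T -> 'rV[R]_n -> R) (z : T -> 'rV[R]_n) :
  (forall q, measurable_fun setT (h ^~ q)) -> (forall t, continuous (h t)) ->
  (forall i, measurable_fun setT (fun t => z t ord0 i)) ->
  measurable_fun setT (fun t => h t (z t)).
Proof.
move=> mh ch mz.
apply: (@measurable_fun_cvg _ _ R setT (fun N t => h t (ungrid N (grid N (z t))))); last first.
  move=> t _; apply: continuous_cvg; [exact: ch|exact: cvg_grid].
move=> N _ A mA; rewrite setTI.
have -> : (fun t => h t (ungrid N (grid N (z t)))) @^-1` A =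
    \bigcup_(k : 'rV[int]_n) ([set t | grid N (z t) = k] `&` (h ^~ (ungrid N k)) @^-1` A).
  apply/seteqP; split => [t /= At|t [k _ [/= <- //]]].
  by exists (grid N (z t)).
apply: countable_bigcupT_measurable => [|k].
  exact: countableP.
apply: measurableI; last by rewrite -[X in measurable X]setTI; exact: mh.
have -> : [set t | grid N (z t) = k] =
    \bigcap_(i in [set: 'I_n]) ((fun t => z t ord0 i * N.+1%:R) @^-1` `[(k ord0 i)%:~R, (k ord0
      i + 1)%:~R[).
  apply/seteqP; split => [t /= <- i _ /=|t /= H].
    by rewrite in_itv /= mxE floor_itv.
  apply/rowP => i; rewrite mxE; apply/eqP; rewrite floor_eq.
  by have := H i I; rewrite /= in_itv.
apply: fin_bigcap_measurable => [|i _]; first exact: finite_finset.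
rewrite -[X in measurable X]setTI; exact: measurable_funM.
Qed.

End caratheodory.

(** * Independence of the past and a fresh sample *)

Section independence.
Context {R : realType} (dO dX : measure_display) (Omega : measurableType dO)
  (Xi : measurableType dX).
Variables (P : probability Omega R) (D : probability Xi R) (xi : nat -> Omega -> Xi).
Hypothesis iid : iid_samples P D xi.

(** Finite intersections, not single preimages: this makes the family closed under intersection and
    fits the product formula in [iid_samples]. *)
Definition cylinder (t : nat) : set (set Omega) :=
  [set C | exists2 A : nat -> set Xi, forall i, measurable (A i) &
    C = \bigcap_(i in [set i | (0 < i <= t)%N]) (xi i @^-1` A i)].

(** The same points as [Omega] with the smaller sigma-algebra of the first [t] samples, so that
    being determined by the past becomes ordinary measurability. *)
Definition past (t : nat) := g_sigma_algebraType (cylinder t).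

Lemma measurable_sample t : measurable_fun setT (xi t).
Proof. by case: iid => h _; exact: h. Qed.

Lemma cylinder_measurable t : cylinder t `<=` measurable.
Proof.
move=> _ [A mA ->]; apply: bigcap_measurableType => i _.
 rewrite -[X in measurable X]setTI; exact: measurable_sample.
Qed.

Lemma cylinder_setI t : setI_closed (cylinder t).
Proof.
move=> _ _ [A mA ->] [B mB ->]; exists (fun i => A i `&` B i).
  by move=> i; exact: measurableI.
by rewrite -bigcapI.
Qed.

Lemma cylinder_setT t : cylinder t setT.
Proof.
exists (fun=> setT); first by [].
by apply/seteqP; split => // o _ i _.
Qed.

Lemma past_measurable t (A : set Omega) :
  (@measurable _ (past t)) A -> measurable A.
Proof.
move: A; apply: smallest_sub; first exact: sigma_algebra_measurable.
exact: cylinder_measurable.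
Qed.

Lemma measurable_fun_past t : measurable_fun setT (id : Omega -> past t).
Proof. by move=> _ A mA; rewrite setTI; exact: (@past_measurable t A mA). Qed.

Lemma measurable_sample_past i t : (0 < i <= t)%N ->
  measurable_fun setT (xi i : past t -> Xi).
Proof.
move=> it _ B mB; rewrite setTI; apply: sub_sigma_algebra.
exists (fun j => if j == i then B else setT) => [j|]; first by case: ifP.
apply/seteqP; split => [w /= Bw j _ /=|w /(_ i it)]; last by rewrite eqxx.
by case: eqP => [->|].
Qed.

Local Open Scope ereal_scope.

(** As functions of [A] both sides are finite measures. They agree on the cylinders, which form a
    generating family closed under intersection, so they coincide. *)
Lemma indep_past t (A : set Omega) (B : set Xi) :
  (@measurable _ (past t)) A -> measurable B ->
  P (A `&` xi t.+1 @^-1` B) = P A * D B.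
Proof.
move=> mA mB.
have mxB : measurable (xi t.+1 @^-1` B).
  by rewrite -[X in measurable X]setTI; exact: measurable_sample.
have DBfin : D B \is a fin_num by exact: fin_num_measure.
have DB0 : (0 <= fine (D B))%R by exact: fine_ge0.
pose m1 := mrestr P mxB; pose m2 := mscale (NngNum DB0) P.
suff : m1 A = m2 A.
  by rewrite /m1 /m2 /mrestr /mscale /= fineK// muleC.
apply: (@g_sigma_algebra_measure_unique _ R Omega (cylinder t) (@cylinder_measurable t) (fun=>
  setT)) => //.
- by move=> _; exact: cylinder_setT.
- by rewrite bigcup_const.
- exact: cylinder_setI.
- move=> _ [C mC ->]; rewrite -[LHS]/(P (_ `&` _)) -[RHS]/((fine (D B))%:E * P _) fineK// muleC.
  have [_ Pcyl] := iid.
  (* A cylinder of length [t] intersected with a condition on sample [t + 1] is a cylinder of length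
     [t + 1]. *)
  have := Pcyl t.+1 (fun j => if j == t.+1 then B else C j) (fun j => _).
  rewrite big_nat_recr//= eqxx.
  have -> : \prod_(1 <= i < t.+1) D (if i == t.+1 then B else C i) = P (\bigcap_(i in [set i |
    (0 < i <= t)%N]) (xi i @^-1` C i)).
    rewrite Pcyl//; apply: eq_big_nat => i /andP[_ it].
    by rewrite (ltn_eqF it).
  move=> <- => [|j]; last by case: ifP.
  congr (P _); apply/seteqP; split => [w [/= h1 h2] i /= /andP[i0 it]|w /= h].
    have [->//|it'] := eqVneq i t.+1.
    by apply: h1; rewrite /= i0 /= -ltnS ltn_neqAle it' it.
  split => [i /= /andP[i0 it]|].
    have := h i; rewrite /= i0 (leqW it) => /(_ isT).
    by rewrite (@ltn_eqF i).
  by have := h t.+1; rewrite /= leqnn eqxx => /(_ isT).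
- move=> _; rewrite -[X in X < _]/(P (_ `&` _)) setTI.
  by apply: le_lt_trans (probability_le1 _ _) (ltry _).
Qed.

(** By [indep_past] the joint law of the past and the next sample agrees with the product law on
    rectangles, hence everywhere. *)
Lemma tonelli_past t (h : past t * Xi -> \bar R) :
  measurable_fun setT h -> (forall z, 0 <= h z) ->
  \int[P]_o h (o, xi t.+1 o) = \int[P]_o \int[D]_s h (o, s).
Proof.
move=> mh h0.
pose idm := isMeasurableFun.Build _ _ _ _ _ (@measurable_fun_past t).
pose idp : {mfun Omega >-> past t} := HB.pack (id : Omega -> past t) idm.
have mpair : @measurable_fun _ _ Omega (past t * Xi)%type setT (fun o => (o, xi t.+1 o)).
  exact: (measurable_fun_pair (@measurable_fun_past t) (measurable_sample t.+1)).
pose prm := isMeasurableFun.Build _ _ _ _ _ mpair.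
pose pr : {mfun Omega >-> (past t * Xi)%type} := HB.pack ((fun o => (o, xi t.+1 o)) : Omega ->
  past t * Xi) prm.
pose Q := distribution P idp; pose J := distribution P pr.
transitivity (\int[J]_z h z).
  by rewrite ge0_integral_distribution.
transitivity (\int[Q \x D]_z h z).
  apply: eq_measure_integral => A mA _; apply/esym.
  apply: product_measure_unique => // A1 B1 mA1 mB1.
  exact: (@indep_past t A1 B1 mA1 mB1).
rewrite fubini_tonelli1// ge0_integral_distribution//.
  exact: measurable_fun_fubini_tonelli_F.
by move=> o; apply: integral_ge0 => s _.
Qed.

Lemma measurable_fun_inner t (h : past t * Xi -> \bar R) :
  measurable_fun setT h -> (forall z, 0 <= h z) ->
  measurable_fun (setT : set Omega) (fun o => \int[D]_s h (o, s)).
Proof.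
move=> mh h0 _ A mA.
have := measurable_fun_fubini_tonelli_F h mh h0 measurableT A mA.
by move=> /(_ D) hA; have := @past_measurable t _ hA; rewrite !setTI.
Qed.

End independence.

(** * Means and the variance of the momentum estimator *)

Section mean.
Context {R : realType} (dX : measure_display) (Xi : measurableType dX)
  (D : probability Xi R).
Implicit Types (X Y : Xi -> R) (m : R).

Definition has_mean X m :=
  D.-integrable setT (fun s => (X s)%:E) /\ (\int[D]_s (X s)%:E)%E = m%:E.

Lemma has_mean_cst m : has_mean (fun=> m) m.
Proof.
split; first exact: finite_measure_integrable_cst.
rewrite -[RHS]mule1 -(@probability_setT _ _ _ D); exact: (integral_cst D measurableT m%:E).
Qed.

Lemma has_meanD X Y m m' : has_mean X m -> has_mean Y m' ->
  has_mean (fun s => X s + Y s) (m + m').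
Proof.
move=> [iX EX] [iY EY]; split.
  by under eq_fun do rewrite EFinD; exact: integrableD.
by under eq_integral do rewrite EFinD; rewrite integralD// EX EY.
Qed.

Lemma has_meanZ a X m : has_mean X m -> has_mean (fun s => a * X s) (a * m).
Proof.
move=> [iX EX]; split.
  by under eq_fun do rewrite EFinM; exact: integrableZl.
by under eq_integral do rewrite EFinM; rewrite integralZl// EX.
Qed.

Lemma has_meanB X Y m m' : has_mean X m -> has_mean Y m' ->
  has_mean (fun s => X s - Y s) (m - m').
Proof.
move=> hX hY; have -> : (fun s => X s - Y s) = (fun s => X s + -1 * Y s).
  by apply/funext => s; rewrite mulN1r.
by rewrite -(mulN1r m'); apply: has_meanD => //; exact: has_meanZ.
Qed.

Lemma has_mean_sum n (X : 'I_n -> Xi -> R) (m : 'I_n -> R) :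
  (forall i, has_mean (X i) (m i)) ->
  has_mean (fun s => \sum_(i < n) X i s) (\sum_(i < n) m i).
Proof.
elim: n X m => [|n IH] X m H.
  rewrite big_ord0; under [fun s => _]eq_fun do rewrite big_ord0.
  exact: has_mean_cst.
rewrite big_ord_recr; under [fun s => _]eq_fun do rewrite big_ord_recr.
by apply: has_meanD => //; exact: IH.
Qed.

Lemma has_mean_dotp n (u m : 'rV[R]_n) (g : Xi -> 'rV[R]_n) :
  (forall i, has_mean (fun s => g s ord0 i) (m ord0 i)) ->
  has_mean (fun s => dotp u (g s)) (dotp u m).
Proof. by move=> H; apply: has_mean_sum => i; exact: has_meanZ. Qed.

Lemma has_mean_le X Y m m' : has_mean X m -> has_mean Y m' ->
  (forall s, X s <= Y s) -> m <= m'.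
Proof.
move=> [iX EX] [iY EY] XY; rewrite -lee_fin -EX -EY.
by apply: le_integral => // s _; rewrite lee_fin.
Qed.

Lemma measurable_dotp d' (T : measurableType d') n (u v : T -> 'rV[R]_n) :
  (forall i, measurable_fun setT (fun t => u t ord0 i)) ->
  (forall i, measurable_fun setT (fun t => v t ord0 i)) ->
  measurable_fun setT (fun t => dotp (u t) (v t)).
Proof. by move=> mu mv; apply: measurable_sum => i; exact: measurable_funM. Qed.

Lemma measurable_sqrtr d' (T : measurableType d') (X : T -> R) :
  measurable_fun setT X -> measurable_fun setT (fun t => Num.sqrt (X t)).
Proof.
move=> mX; apply: (measurableT_comp (f := @Num.sqrt R)) => //.
apply: continuous_measurable_fun; exact: (@sqrt_continuous R).
Qed.

Lemma measurable_enorm d' (T : measurableType d') n (u : T -> 'rV[R]_n) :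
  (forall i, measurable_fun setT (fun t => u t ord0 i)) ->
  measurable_fun setT (fun t => enorm (u t)).
Proof.
move=> mu; apply: measurable_sqrtr.
by apply: measurable_sum => i; exact: measurable_funX.
Qed.

(** Testing the mean against itself gives [|m|^2 = E <m, g> <= |m| C]. It transfers the Lipschitz
    bounds from the samples to [f]. *)
Lemma enorm_mean_le n (m : 'rV[R]_n) (g : Xi -> 'rV[R]_n) (C : R) :
  (forall i, has_mean (fun s => g s ord0 i) (m ord0 i)) ->
  (forall s, enorm (g s) <= C) -> enorm m <= C.
Proof.
move=> H gC.
have C0 : 0 <= C := le_trans (enorm_ge0 _) (gC point).
have : dotp m m <= enorm m * C.
  apply: (has_mean_le (has_mean_dotp m H) (has_mean_cst _)) => s.
  by apply: le_trans (dotp_le_enorm _ _) _; rewrite ler_wpM2l ?enorm_ge0.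
rewrite -enorm_sqr expr2; have := enorm_ge0 m; rewrite le_eqVlt => /predU1P[<-//|m0].
by rewrite ler_pM2l.
Qed.

(* The error splits as [(1 - b) e + b A + (1 - b) (A - B)] with centred noises
   [A], [B] at the new and the old point; the cross term with [e] vanishes in
   the mean and the variance of [A - B] is at most the mean square of [g1 - g0]. *)
Lemma momentum_variance n (g0 g1 : Xi -> 'rV[R]_n) (m0 m1 w : 'rV[R]_n)
    (b C sg : R) :
  (forall i, has_mean (fun s => g0 s ord0 i) (m0 ord0 i)) ->
  (forall i, has_mean (fun s => g1 s ord0 i) (m1 ord0 i)) ->
  (forall s, enorm (g1 s - g0 s) ^+ 2 <= C) ->
  (\int[D]_s (enorm (m1 - g1 s) ^+ 2)%:E <= sg%:E)%E ->
  (\int[D]_s (enorm (m1 - (g1 s + (1 - b) *: (w - g0 s)))%R ^+ 2)%:E <=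
   ((1 - b) ^+ 2 * enorm (m0 - w)%R ^+ 2 + 2 * b ^+ 2 * sg + 2 * (1 - b) ^+ 2 * C)%:E)%E.
Proof.
move=> H0 H1 HC Hsg.
have mg0 i : measurable_fun setT (fun s => g0 s ord0 i).
  by have [/integrableP[/measurable_EFinP]] := H0 i.
have mg1 i : measurable_fun setT (fun s => g1 s ord0 i).
  by have [/integrableP[/measurable_EFinP]] := H1 i.
have mA i : measurable_fun setT (fun s => (m1 - g1 s) ord0 i).
  by under eq_fun do rewrite !mxE; exact: measurable_funB.
have mA2 : measurable_fun setT (fun s => enorm (m1 - g1 s) ^+ 2).
  by apply: measurable_funX; exact: measurable_enorm.
have mL : measurable_fun setT (fun s => enorm (m1 - (g1 s + (1 - b) *: (w - g0 s))) ^+ 2).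
  apply: measurable_funX; apply: measurable_enorm => i.
  under eq_fun do rewrite !mxE; apply: measurable_funB => //.
  by apply: measurable_funD => //; apply: measurable_funM => //; exact: measurable_funB.
have [vA [HA vAsg]] : exists vA, has_mean (fun s => enorm (m1 - g1 s) ^+ 2) vA /\ vA <= sg.
  have Ifin : (\int[D]_s (enorm (m1 - g1 s) ^+ 2)%:E)%E \is a fin_num.
    rewrite ge0_fin_numE; first exact: le_lt_trans Hsg (ltry _).
    by apply: integral_ge0 => s _; rewrite lee_fin sqr_ge0.
  exists (fine (\int[D]_s (enorm (m1 - g1 s) ^+ 2)%:E)); split; last first.
    by rewrite -lee_fin fineK.
  split; last by rewrite fineK.
  apply/integrableP; split; first exact/measurable_EFinP.
  under eq_integral => s _ do rewrite gee0_abs ?lee_fin ?sqr_ge0//.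
  exact: le_lt_trans Hsg (ltry _).
pose e := m0 - w; pose m := m1 - m0.
(* These are the coefficients of the expanded square once [|g1 - g0|^2] is replaced by [C]. Apart
   from [|m1 - g1|^2] the bound is then affine in the samples, and linearity gives its mean. *)
pose p1 : 'rV[R]_n := - (2 * (1 - b)) *: e - (4 * (1 - b) ^+ 2) *: m.
pose p0 : 'rV[R]_n := (2 * (1 - b) ^+ 2) *: e + (4 * (1 - b) ^+ 2) *: m.
pose c := (1 - b) ^+ 2 * dotp e e + 2 * (1 - b) * dotp e (m1 - (1 - b) *: m0)
          + 2 * (1 - b) ^+ 2 * (dotp m m + C).
have HU : has_mean (fun s => 2 * b ^+ 2 * enorm (m1 - g1 s) ^+ 2 +
     (c + (dotp p1 (g1 s) + dotp p0 (g0 s))))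
    (2 * b ^+ 2 * vA + (c + (dotp p1 m1 + dotp p0 m0))).
  apply: has_meanD; first exact: has_meanZ.
  apply: has_meanD; first exact: has_mean_cst.
  by apply: has_meanD; exact: has_mean_dotp.
have pt s : enorm (m1 - (g1 s + (1 - b) *: (w - g0 s))) ^+ 2 <=
    2 * b ^+ 2 * enorm (m1 - g1 s) ^+ 2 + (c + (dotp p1 (g1 s) + dotp p0 (g0 s))).
  have h1 : 0 <= (1 - b) ^+ 2 * (C - dotp (g1 s - g0 s) (g1 s - g0 s)).
    by rewrite mulr_ge0 ?sqr_ge0// subr_ge0 -enorm_sqr; exact: HC.
  have h2 := dotp_ge0 (b *: (m1 - g1 s) - (1 - b) *: ((m1 - g1 s) - (m0 - g0 s))).
  move: h1 h2; rewrite !enorm_sqr /c /p1 /p0 /e /m.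
  rewrite !(dotpDl, dotpDr, dotpZl, dotpZr, dotpNl, dotpNr).
  rewrite !(dotpC _ m1) !(dotpC _ m0) !(dotpC _ w) (dotpC (g0 s) (g1 s)).
  rewrite ?(dotpC w m1) ?(dotpC w m0) ?(dotpC m0 m1).
  lra.
apply: (@le_trans _ _ (2 * b ^+ 2 * vA + (c + (dotp p1 m1 + dotp p0 m0)))%:E).
  rewrite -HU.2; apply: ge0_le_integral => //.
  - by move=> s _; rewrite lee_fin sqr_ge0.
  - exact/measurable_EFinP.
  - by have [/integrableP[]] := HU.
  - by move=> s _; rewrite lee_fin.
rewrite lee_fin.
have : b ^+ 2 * vA <= b ^+ 2 * sg by rewrite ler_wpM2l ?sqr_ge0.
have : 0 <= (1 - b) ^+ 2 * dotp m m by rewrite mulr_ge0 ?sqr_ge0 ?dotp_ge0.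
rewrite !enorm_sqr /c /p1 /p0 /e /m.
rewrite !(dotpDl, dotpDr, dotpZl, dotpZr, dotpNl, dotpNr).
rewrite !(dotpC _ m1) !(dotpC _ w) ?(dotpC w m1).
lra.
Qed.

End mean.

Section momentum_step.
Context {R : realType} (dO dX : measure_display) (Omega : measurableType dO)
  (Xi : measurableType dX).
Variables (P : probability Omega R) (D : probability Xi R) (xi : nat -> Omega -> Xi).
Hypothesis iid : iid_samples P D xi.

Definition row_measurable dU (U : measurableType dU) n (X : U -> 'rV[R]_n) :=
  forall i, measurable_fun setT (fun u => X u ord0 i).

Variables (d p n : nat) (g : Xi -> 'rV[R]_d -> 'rV[R]_p -> 'rV[R]_n)
  (gbar : 'rV[R]_d -> 'rV[R]_p -> 'rV[R]_n) (Lf sg : R).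
Hypothesis g_mean : forall x y i, has_mean D (fun s => g s x y ord0 i) (gbar x y ord0 i).
Hypothesis g_var : forall x y, (\int[D]_s (enorm (gbar x y - g s x y) ^+ 2)%:E <= sg%:E)%E.
Hypothesis g_lipx : forall s x x' y, enorm (g s x y - g s x' y) <= Lf * enorm (x - x').
Hypothesis g_lipy : forall s x y y', enorm (g s x y - g s x y') <= Lf * enorm (y - y').

Lemma mean_lipx x x' y : enorm (gbar x y - gbar x' y) <= Lf * enorm (x - x').
Proof.
apply: (@enorm_mean_le _ _ _ D _ _ (fun s => g s x y - g s x' y)) => // i.
rewrite !mxE; under [fun s => _]eq_fun do rewrite !mxE.
exact: has_meanB.
Qed.

Lemma mean_lipy x y y' : enorm (gbar x y - gbar x y') <= Lf * enorm (y - y').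
Proof.
apply: (@enorm_mean_le _ _ _ D _ _ (fun s => g s x y - g s x y')) => // i.
rewrite !mxE; under [fun s => _]eq_fun do rewrite !mxE.
exact: has_meanB.
Qed.

(** The Lipschitz bounds hold in each argument separately, so the Caratheodory argument is applied
    once per argument instead of jointly. *)
Lemma row_measurable_comp dU (U : measurableType dU) (G : U -> 'rV[R]_d -> 'rV[R]_p -> 'rV[R]_n)
    (X : U -> 'rV[R]_d) (Y : U -> 'rV[R]_p) :
  (forall x y, row_measurable (fun u => G u x y)) ->
  (forall u x x' y, enorm (G u x y - G u x' y) <= Lf * enorm (x - x')) ->
  (forall u x y y', enorm (G u x y - G u x y') <= Lf * enorm (y - y')) ->
  row_measurable X -> row_measurable Y ->
  row_measurable (fun u => G u (X u) (Y u)).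
Proof.
move=> mG lx ly mX mY i.
apply: (@measurable_caratheodory _ _ _ _ (fun u y => G u (X u) y ord0 i)) => // [y|u].
  apply: (@measurable_caratheodory _ _ _ _ (fun u x => G u x y ord0 i)) => // [x|u].
    exact: mG.
  apply: (@lipschitz_continuous _ _ _ Lf) => x x'; apply: le_trans (lx u x x' y).
  by have := normr_le_enorm (G u x y - G u x' y) i; rewrite !mxE.
apply: (@lipschitz_continuous _ _ _ Lf) => y y'; apply: le_trans (ly u (X u) y y').
by have := normr_le_enorm (G u (X u) y - G u (X u) y') i; rewrite !mxE.
Qed.

Lemma row_measurable_sample_grad dU (U : measurableType dU) (S : U -> Xi)
    (X : U -> 'rV[R]_d) (Y : U -> 'rV[R]_p) :
  measurable_fun setT S -> row_measurable X -> row_measurable Y ->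
  row_measurable (fun u => g (S u) (X u) (Y u)).
Proof.
move=> mS; apply: (@row_measurable_comp _ _ (fun u => g (S u))) => // x y i.
have [/integrableP[/measurable_EFinP mg _] _] := g_mean x y i.
exact: (measurableT_comp mg mS).
Qed.

Lemma row_measurable_mean_grad dU (U : measurableType dU)
    (X : U -> 'rV[R]_d) (Y : U -> 'rV[R]_p) :
  row_measurable X -> row_measurable Y -> row_measurable (fun u => gbar (X u) (Y u)).
Proof.
apply: (@row_measurable_comp _ _ (fun=> gbar)) => [x y i|_|_]; first exact: measurable_cst.
  exact: mean_lipx.
exact: mean_lipy.
Qed.

Lemma row_measurableD dU (U : measurableType dU) q (X Y : U -> 'rV[R]_q) :
  row_measurable X -> row_measurable Y -> row_measurable (fun u => X u + Y u).
Proof. by move=> mX mY i; under eq_fun do rewrite mxE; exact: measurable_funD. Qed.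

Lemma row_measurableZ dU (U : measurableType dU) q (a : R) (X : U -> 'rV[R]_q) :
  row_measurable X -> row_measurable (fun u => a *: X u).
Proof. by move=> mX i; under eq_fun do rewrite mxE; exact: measurable_funM. Qed.

Lemma row_measurableB dU (U : measurableType dU) q (X Y : U -> 'rV[R]_q) :
  row_measurable X -> row_measurable Y -> row_measurable (fun u => X u - Y u).
Proof. by move=> mX mY i; under eq_fun do rewrite !mxE; exact: measurable_funB. Qed.

Lemma measurable_sqnorm dU (U : measurableType dU) q (X : U -> 'rV[R]_q) :
  row_measurable X -> measurable_fun setT (fun u => enorm (X u) ^+ 2).
Proof. by move=> mX; apply: measurable_funX; exact: measurable_enorm. Qed.

Lemma row_measurable_past q t (X : Omega -> 'rV[R]_q) :
  @row_measurable _ (past xi t) _ X -> row_measurable X.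
Proof.
move=> mX i _ A mA; have := mX i measurableT A mA.
by rewrite !setTI; exact: (@past_measurable _ _ _ _ _ _ _ _ iid t).
Qed.

(** The next iterates [X'], [Y'] are already determined by the past; only the gradients use sample
    [t + 1]. With the past frozen, [momentum_variance] therefore applies to the inner integral. *)
Lemma momentum_step t (b : R) (X X' : Omega -> 'rV[R]_d) (Y Y' : Omega -> 'rV[R]_p)
    (u : Omega -> 'rV[R]_n) (E' B : Omega -> R) :
  @row_measurable _ (past xi t) _ X -> @row_measurable _ (past xi t) _ X' ->
  @row_measurable _ (past xi t) _ Y -> @row_measurable _ (past xi t) _ Y' ->
  @row_measurable _ (past xi t) _ u ->
  (forall o, E' o = enorm (gbar (X' o) (Y' o) - (g (xi t.+1 o) (X' o) (Y' o)
       + (1 - b) *: (u o - g (xi t.+1 o) (X o) (Y o)))) ^+ 2) ->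
  (forall o, B o = (1 - b) ^+ 2 * enorm (gbar (X o) (Y o) - u o) ^+ 2 + 2 * b ^+ 2 * sg
       + 2 * (1 - b) ^+ 2 * (2 * Lf ^+ 2 * (dotp (X' o - X o) (X' o - X o)
                                     + dotp (Y' o - Y o) (Y' o - Y o)))) ->
  (\int[P]_o (E' o)%:E <= \int[P]_o (B o)%:E)%E.
Proof.
move=> mX mX' mY mY' mu EE EB.
under eq_integral do rewrite EE; under [leRHS]eq_integral do rewrite EB.
pose h (z : past xi t * Xi) : \bar R := (enorm (gbar (X' z.1) (Y' z.1) - (g z.2 (X' z.1) (Y' z.1)
       + (1 - b) *: (u z.1 - g z.2 (X z.1) (Y z.1))))%R ^+ 2)%:E.
have m1 q (Z : Omega -> 'rV[R]_q) : @row_measurable _ (past xi t) _ Z ->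
    row_measurable (fun z : past xi t * Xi => Z z.1).
  by move=> mZ i; exact: (measurableT_comp (mZ i) measurable_fst).
have mh : measurable_fun setT h.
  apply/measurable_EFinP; apply: measurable_sqnorm; apply: row_measurableB.
    by apply: row_measurable_mean_grad; exact: m1.
  apply: row_measurableD.
    by apply: row_measurable_sample_grad; [exact: measurable_snd|exact: m1|exact: m1].
  apply: row_measurableZ; apply: row_measurableB; first exact: m1.
  by apply: row_measurable_sample_grad; [exact: measurable_snd|exact: m1|exact: m1].
have h0 z : (0 <= h z)%E by rewrite lee_fin sqr_ge0.
rewrite (tonelli_past iid mh h0); apply: ge0_le_integral => //.
- by move=> o _; apply: integral_ge0.
- exact: (measurable_fun_inner iid mh h0).
- apply/measurable_EFinP.
  have oX := row_measurable_past mX; have oX' := row_measurable_past mX'.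
  have oY := row_measurable_past mY; have oY' := row_measurable_past mY'.
  have ou := row_measurable_past mu.
  apply: measurable_funD; first apply: measurable_funD => //.
    apply: measurable_funM => //; apply: measurable_sqnorm; apply: row_measurableB => //.
    exact: row_measurable_mean_grad.
  apply: measurable_funM => //; apply: measurable_funM => //; apply: measurable_funD.
    by apply: measurable_dotp; exact: row_measurableB.
  by apply: measurable_dotp; exact: row_measurableB.
- move=> o _; rewrite /h /=.
  apply: (@momentum_variance _ _ _ D n (fun s => g s (X o) (Y o)) (fun s => g s (X' o) (Y' o))
    (gbar (X o) (Y o)) (gbar (X' o) (Y' o)) (u o) b _ sg); last exact: g_var.
  - by move=> i; exact: g_mean.
  - by move=> i; exact: g_mean.
  move=> s; set q1 := X' o - X o; set q2 := Y' o - Y o.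
  have Lf0 : 0 <= Lf * enorm q1 := le_trans (enorm_ge0 _) (g_lipx s _ _ (Y' o)).
  have Lf1 : 0 <= Lf * enorm q2 := le_trans (enorm_ge0 _) (g_lipy s (X o) _ _).
  have : enorm (g s (X' o) (Y' o) - g s (X o) (Y o)) <= Lf * enorm q1 + Lf * enorm q2.
    rewrite -(subrK (g s (X o) (Y' o)) (g s (X' o) (Y' o))) -addrA.
    by apply: le_trans (enormD _ _) _; apply: lerD.
  (* Moving one argument at a time costs the factor 2 in [(a + b)^2 <= 2 (a^2 + b^2)]. *)
  move=> h1; apply: (@le_trans _ _ ((Lf * enorm q1 + Lf * enorm q2) ^+ 2)).
    by rewrite ler_pXn2r ?nnegrE ?enorm_ge0 ?addr_ge0.
  rewrite -!enorm_sqr; have := sqr_ge0 (Lf * enorm q1 - Lf * enorm q2).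
  by rewrite sqrrB sqrrD !exprMn; lra.
Qed.

End momentum_step.

(** * Step sizes *)

Section schedule.
Context {R : realType}.
Implicit Types (a b k m x : R).

Lemma powR_natK x (n : nat) : 0 <= x -> (x `^ n.+1%:R^-1) ^+ n.+1 = x.
Proof.
move=> x0; rewrite -powR_mulrn ?powR_ge0// -powRrM mulVf ?pnatr_eq0//.
by rewrite powRr1.
Qed.

Lemma cbrt_cube x : 0 <= x -> (x `^ 3^-1) ^+ 3 = x.
Proof. exact: (@powR_natK x 2). Qed.

Lemma cbrt_gt0 x : 0 < x -> 0 < x `^ 3^-1.
Proof. exact: powR_gt0. Qed.

Lemma ler_cube a b : 0 <= b -> a ^+ 3 <= b ^+ 3 -> a <= b.
Proof.
move=> b0 h; have [a0|a0] := ltP a 0; first exact: le_trans (ltW a0) b0.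
by rewrite -(@ler_pXn2r _ 3) ?nnegrE.
Qed.

Lemma cbrtD a b : 0 <= a -> 0 <= b -> (a + b) `^ 3^-1 <= a `^ 3^-1 + b `^ 3^-1.
Proof.
move=> a0 b0; apply: ler_cube; first by rewrite addr_ge0 ?powR_ge0.
rewrite cbrt_cube ?addr_ge0// -{1}(cbrt_cube a0) -{1}(cbrt_cube b0).
set u := a `^ _; set v := b `^ _.
have u0 : 0 <= u by exact: powR_ge0.
have v0 : 0 <= v by exact: powR_ge0.
have -> : (u + v) ^+ 3 = u ^+ 3 + v ^+ 3 + 3 * (u * v) * (u + v) by ring.
by rewrite lerDl mulr_ge0 ?addr_ge0// mulr_ge0// mulr_ge0.
Qed.

Lemma step_le1 k m t : 0 < k -> 0 < m -> 0 <= t -> k ^+ 3 <= m ->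
  0 < k / (m + t) `^ 3^-1 <= 1.
Proof.
move=> k0 m0 t0 km; have mt : 0 < m + t by rewrite ltr_wpDr.
rewrite divr_gt0 ?cbrt_gt0//= ler_pdivrMr ?cbrt_gt0// mul1r.
apply: ler_cube; rewrite ?powR_ge0// cbrt_cube ?(ltW mt)//.
by rewrite (le_trans km)// lerDl.
Qed.

(** Here [b^3 - b'^3 = 1] and [b <= 2 b'], because [x + 1 <= 8 x]. Factoring the difference of cubes
    gives [b - b' <= 2 / (3 b^2)], and [k <= b] does the rest. *)
Lemma step_gap k x : 0 < k -> 2 <= x -> k ^+ 3 <= x ->
  (k / (x + 1) `^ 3^-1)^-1 - (k / x `^ 3^-1)^-1 <= 2 / (3 * k ^+ 3) * (k / (x + 1) `^ 3^-1).
Proof.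
move=> k0 x2 kx; have x0 : 0 < x by lra.
have y0 : 0 < x + 1 by lra.
have := cbrt_cube (ltW x0); have := cbrt_cube (ltW y0).
have := cbrt_gt0 x0; have := cbrt_gt0 y0.
set b := (x + 1) `^ _; set b' := x `^ _ => b0 b'0 bE b'E.
have kb : k <= b by apply: ler_cube; [exact: ltW|rewrite bE; lra].
have bb : b / 2 <= b'.
  apply: ler_cube; first exact: ltW.
  rewrite b'E; have -> : (b / 2) ^+ 3 = b ^+ 3 / 8 by field.
  by rewrite bE; lra.
have b'b : b' <= b by apply: ler_cube; [exact: ltW|rewrite bE b'E; lra].
rewrite !invf_div -mulrBl.
have -> : 2 / (3 * k ^+ 3) * (k / b) = 2 / (3 * k * b) / k.
  by field; rewrite !gt_eqF.
rewrite ler_wpM2r ?invr_ge0 ?(ltW k0)//.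
rewrite ler_pdivlMr; last by rewrite mulr_gt0// mulr_gt0.
have h1 : (b - b') * (3 * k * b) <= (b - b') * (3 * b * b).
  by rewrite ler_wpM2l ?subr_ge0// ler_wpM2r ?(ltW b0)// ler_wpM2l.
have h2 : (b - b') * (3 * b * b) <= (b - b') * (2 * (b ^+ 2 + b * b' + b' ^+ 2)).
  rewrite ler_wpM2l ?subr_ge0//.
  have h3 : b * (b / 2) <= b * b' by rewrite ler_wpM2l// ltW.
  by have := sqr_ge0 b'; lra.
apply: le_trans h1 _; apply: le_trans h2 _.
have -> : (b - b') * (2 * (b ^+ 2 + b * b' + b' ^+ 2)) = 2 * (b ^+ 3 - b' ^+ 3) by ring.
by rewrite bE b'E; lra.
Qed.

(** The induction step is [ln (x - 1) = ln x + ln (1 - 1/x) <= ln x - 1/x]. *)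
Lemma sum_inv_le_ln m T : 1 <= m ->
  \sum_(1 <= t < T.+1) (m + t%:R)^-1 <= ln (m + T%:R).
Proof.
move=> m1; elim: T => [|T IH].
  by rewrite big_geq// addr0 ln_ge0.
rewrite big_nat_recr//=; set x := m + T.+1%:R.
have xE : m + T%:R = x - 1 by rewrite /x -(natr1 T) addrA addrK.
have T0 : 0 <= T%:R :> R by [].
have x1 : 0 < x - 1 by rewrite -xE; lra.
have x0 : 0 < x by lra.
apply: le_trans (lerD IH (lexx _)) _; rewrite xE -lerBrDr.
have -> : ln x - x^-1 = ln x + (- x^-1) by [].
have -> : x - 1 = x * (1 - x^-1) by rewrite mulrBr mulfV ?gt_eqF// mulr1.
have y0 : 0 < 1 - x^-1 by rewrite -(pmulr_rgt0 _ x0) mulrBr mulfV ?gt_eqF// mulr1.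
rewrite lnM ?posrE// lerD2l.
by have := @le_ln1Dx R (- x^-1); apply; lra.
Qed.

(** Subadditivity of the cube root splits the left side into the squares of the two summands on the
    right, and the sum of two squares is at most the square of the sum. *)
Lemma rate_bound (H m T : R) : 0 <= H -> 0 < m -> 1 <= T ->
  12 * H * (m + T) `^ 3^-1 / T <=
  (2 * Num.sqrt (3 * H) * m `^ 6^-1 / T `^ 2^-1 + 2 * Num.sqrt (3 * H) / T `^ 3^-1) ^+ 2.
Proof.
move=> H0 m0 T1; have T0 : 0 < T by lra.
have sE : Num.sqrt (3 * H) ^+ 2 = 3 * H by rewrite sqr_sqrtr// mulr_ge0.
have s0 := sqrtr_ge0 (3 * H); set s := Num.sqrt _ in sE s0 *.
have uE : (m `^ 6^-1) ^+ 2 = m `^ 3^-1.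
  rewrite -powR_mulrn ?powR_ge0// -powRrM; congr (_ `^ _); by field.
have u0 := powR_ge0 m (6^-1); set u := m `^ 6^-1 in uE u0 *.
have tE : (T `^ 2^-1) ^+ 2 = T by exact: (@powR_natK T 1 (ltW T0)).
have t0 : 0 < T `^ 2^-1 by exact: powR_gt0.
set t := T `^ 2^-1 in tE t0 *.
have rE := cbrt_cube (ltW T0); have r0 := cbrt_gt0 T0.
have hD := cbrtD (ltW m0) (ltW T0); rewrite -uE in hD.
set r := T `^ 3^-1 in rE r0 hD *.
apply: (@le_trans _ _ (12 * H * (u ^+ 2 + r) / T)).
  by rewrite ler_wpM2r ?invr_ge0 ?(ltW T0)// ler_wpM2l// mulr_ge0.
have -> : 12 * H * (u ^+ 2 + r) / T = (2 * s * u / t) ^+ 2 + (2 * s / r) ^+ 2.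
  have -> : (2 * s * u / t) ^+ 2 = 4 * s ^+ 2 * u ^+ 2 / t ^+ 2.
    by field; rewrite gt_eqF.
  have -> : (2 * s / r) ^+ 2 = 4 * s ^+ 2 * r / r ^+ 3 by field; rewrite gt_eqF.
  by rewrite sE tE rE; field; rewrite gt_eqF.
have a0 : 0 <= 2 * s * u / t by rewrite divr_ge0 ?(ltW t0)// mulr_ge0// mulr_ge0.
have b0 : 0 <= 2 * s / r by rewrite divr_ge0 ?(ltW r0)// mulr_ge0.
by rewrite sqrrD; have := mulr_ge0 a0 b0; set A := 2 * s * u / t; set B := 2 * s / r; lra.
Qed.

End schedule.

(** * Expectations *)

Section expectation.
Context {R : realType} (dO : measure_display) (Omega : measurableType dO)
  (P : probability Omega R).
Implicit Types (X Y : Omega -> R).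
Local Open Scope ereal_scope.

Definition expect X : \bar R := \int[P]_o (X o)%:E.

Lemma expect_ge0 X : (forall o, 0 <= X o)%R -> 0 <= expect X.
Proof. by move=> X0; apply: integral_ge0 => o _; rewrite lee_fin. Qed.

Lemma expect_cst (a : R) : expect (fun=> a) = a%:E.
Proof. by have [] := has_mean_cst P a. Qed.

Lemma expectD X Y : measurable_fun setT X -> measurable_fun setT Y ->
  (forall o, 0 <= X o)%R -> (forall o, 0 <= Y o)%R ->
  expect (fun o => X o + Y o)%R = expect X + expect Y.
Proof.
move=> mX mY X0 Y0; rewrite /expect; under eq_integral do rewrite EFinD.
rewrite ge0_integralD//; first by move=> o _; rewrite lee_fin.
- exact/measurable_EFinP.
- by move=> o _; rewrite lee_fin.
- exact/measurable_EFinP.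
Qed.

Lemma expectZ (a : R) X : (0 <= a)%R -> measurable_fun setT X ->
  (forall o, 0 <= X o)%R -> expect (fun o => a * X o)%R = a%:E * expect X.
Proof.
move=> a0 mX X0; rewrite /expect; under eq_integral do rewrite EFinM.
rewrite ge0_integralZl//; first exact/measurable_EFinP.
by move=> o _; rewrite lee_fin.
Qed.

Lemma expect_le X Y : measurable_fun setT X -> measurable_fun setT Y ->
  (forall o, 0 <= X o)%R -> (forall o, X o <= Y o)%R -> expect X <= expect Y.
Proof.
move=> mX mY X0 XY; apply: ge0_le_integral => //.
- by move=> o _; rewrite lee_fin.
- exact/measurable_EFinP.
- exact/measurable_EFinP.
- by move=> o _; rewrite lee_fin.
Qed.

Lemma telescope_le (a b : nat -> \bar R) (n : nat -> R) (T : nat) :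
  (forall t, (1 <= t)%N -> a t.+1 + b t <= a t + (n t)%:E) ->
  a T.+1 + \sum_(1 <= t < T.+1) b t <= a 1%N + (\sum_(1 <= t < T.+1) n t)%R%:E.
Proof.
move=> H; elim: T => [|T IH]; first by rewrite !big_geq.
rewrite (big_nat_recr T.+1 _ b)//= (big_nat_recr T.+1 _ n)//= EFinD.
set Sb := \sum_(1 <= t < T.+1) b t; set Sn := (\sum_(1 <= t < T.+1) n t)%R.
rewrite (addeC Sb) addeA; apply: le_trans (leeD (H T.+1 isT) (lexx _)) _.
by rewrite addeAC addeA; exact: leeD.
Qed.

(* AM-GM, [G <= (3 M / c + c) / 2], replaces the Cauchy-Schwarz inequality. *)
Lemma expect_avg_le (G M : nat -> Omega -> R) (T : nat) (S B : R) : (1 <= T)%N ->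
  (forall t, (1 <= t)%N -> measurable_fun setT (G t)) ->
  (forall t, (1 <= t)%N -> measurable_fun setT (M t)) ->
  (forall t o, 0 <= G t o)%R -> (forall t o, 0 <= M t o)%R ->
  (forall t o, (1 <= t)%N -> G t o ^+ 2 <= 3 * M t o)%R ->
  (0 <= B)%R -> (3 * S / T%:R <= B ^+ 2)%R ->
  \sum_(1 <= t < T.+1) expect (M t) <= S%:E ->
  (T%:R^-1)%:E * \sum_(1 <= t < T.+1) expect (G t) <= B%:E.
Proof.
move=> T1 mG mM G0 M0 GM B0 SB HM.
have T0 : (0 < T%:R :> R)%R by rewrite ltr0n.
(* The AM-GM parameter must be positive, and [B] may vanish; hence [B + e], with [e] arbitrary. *)
apply/lee_addgt0Pr => e e0; set c := (B + e)%R.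
have c0 : (0 < c)%R by rewrite ltr_wpDl.
have S0 : (0 <= S)%R.
  by rewrite -lee_fin; apply: le_trans HM; apply: sume_ge0 => t _; exact: expect_ge0.
have Gt t : (1 <= t)%N -> expect (G t) <= (3 / (2 * c))%:E * expect (M t) + (c / 2)%:E.
  move=> t1; have a0 : (0 <= 3 / (2 * c))%R by rewrite divr_ge0// mulr_ge0// ltW.
  rewrite -expectZ//; last exact: mM.
  rewrite -[X in _ + X]expect_cst -expectD//; first last.
  - by move=> _; rewrite divr_ge0// ltW.
  - by move=> o; rewrite mulr_ge0.
  - by apply: measurable_funM => //; exact: mM.
  apply: expect_le => //; first exact: mG.
    by apply: measurable_funD => //; apply: measurable_funM => //; exact: mM.
  move=> o; have -> : (3 / (2 * c) * M t o + c / 2 = (3 * M t o + c ^+ 2) / (2 * c))%R.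
    by field; rewrite gt_eqF.
  rewrite ler_pdivlMr ?mulr_gt0//; have := GM t o t1.
  by have := sqr_ge0 (G t o - c); rewrite sqrrB; lra.
have sumG : \sum_(1 <= t < T.+1) expect (G t) <= ((3 / (2 * c)) * S + T%:R * (c / 2))%R%:E.
  apply: (@le_trans _ _ (\sum_(1 <= t < T.+1) ((3 / (2 * c))%:E * expect (M t) + (c / 2)%:E))).
    rewrite big_nat_cond [leRHS]big_nat_cond; apply: lee_sum => t /andP[/andP[t1 _] _].
    exact: Gt.
  rewrite big_split/= -ge0_sume_distrr; last by move=> t _; exact: expect_ge0.
  rewrite EFinD; apply: leeD.
    by rewrite (EFinM (3 / (2 * c)) S); apply: lee_wpmul2l => //; rewrite lee_fin divr_ge0//
      mulr_ge0// ltW.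
  by rewrite sumEFin lee_fin big_const_nat subn1/= iter_addr_0 mulr_natl.
apply: le_trans (lee_wpmul2l _ sumG) _; first by rewrite lee_fin invr_ge0 ltW.
rewrite -EFinM lee_fin.
have -> : (T%:R^-1 * (3 / (2 * c) * S + T%:R * (c / 2)) = (3 * S / T%:R + c ^+ 2) / (2 * c))%R.
  by field; rewrite !gt_eqF.
rewrite ler_pdivrMr ?mulr_gt0//.
have : (B ^+ 2 <= c ^+ 2)%R by rewrite ler_pXn2r ?nnegrE ?(ltW c0)// lerDl ltW.
by rewrite -/c expr2; move: SB; rewrite !expr2; lra.
Qed.

End expectation.

(** * The algorithm *)

Section msgda.
Context {R : realType} (d p : nat).
Context (dO : measure_display) (Omega : measurableType dO) (P : probability Omega R).
Context (dX : measure_display) (Xi : measurableType dX) (D : probability Xi R).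
Variables (xi : nat -> Omega -> Xi) (fs : Xi -> 'rV[R]_d -> 'rV[R]_p -> R)
  (f : 'rV[R]_d -> 'rV[R]_p -> R) (F : 'rV[R]_d -> R) (Fstar mu Lf sigma : R)
  (k m c1 c2 lambda gamma : R) (x1 : 'rV[R]_d) (y1 : 'rV[R]_p)
  (x w : nat -> Omega -> 'rV[R]_d) (y v : nat -> Omega -> 'rV[R]_p).
Hypothesis iid : iid_samples P D xi.
Hypothesis diff_fx : forall x0 y0, differentiable (fun x' => f x' y0) x0.
Hypothesis diff_fy : forall x0 y0, differentiable (fun y' => f x0 y') y0.
Hypothesis F_max : forall x0, exists ys, (forall y0, f x0 y0 <= f x0 ys) /\ F x0 = f x0 ys.
Hypothesis mu_gt0 : 0 < mu.
Hypothesis Lf_gt0 : 0 < Lf.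
Hypothesis PL : forall x0 y0, 2 * mu * (F x0 - f x0 y0) <= enorm (grady f x0 y0) ^+ 2.
Hypothesis lip_xx : forall s x0 x' y0,
  enorm (gradx (fs s) x0 y0 - gradx (fs s) x' y0) <= Lf * enorm (x0 - x').
Hypothesis lip_xy : forall s x0 y0 y',
  enorm (gradx (fs s) x0 y0 - gradx (fs s) x0 y') <= Lf * enorm (y0 - y').
Hypothesis lip_yx : forall s x0 x' y0,
  enorm (grady (fs s) x0 y0 - grady (fs s) x' y0) <= Lf * enorm (x0 - x').
Hypothesis lip_yy : forall s x0 y0 y',
  enorm (grady (fs s) x0 y0 - grady (fs s) x0 y') <= Lf * enorm (y0 - y').
Hypothesis mean_x : forall x0 y0 i,
  has_mean D (fun s => gradx (fs s) x0 y0 ord0 i) (gradx f x0 y0 ord0 i).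
Hypothesis mean_y : forall x0 y0 i,
  has_mean D (fun s => grady (fs s) x0 y0 ord0 i) (grady f x0 y0 ord0 i).
Hypothesis var_xy : forall x0 y0,
  (\int[D]_s (enorm (gradx f x0 y0 - gradx (fs s) x0 y0) ^+ 2
              + enorm (grady f x0 y0 - grady (fs s) x0 y0) ^+ 2)%:E <= (sigma ^+ 2)%:E)%E.
Hypothesis F_lb : forall x0, Fstar <= F x0.

Let eta (t : nat) := k / (m + t%:R) `^ 3^-1.

Hypothesis k_gt0 : 0 < k.
Hypothesis m_ge2 : 2 <= m.
Hypothesis m_gek3 : k ^+ 3 <= m.
Hypothesis c1_ge : 2 / (3 * k ^+ 3) + 9 * Lf ^+ 2 / mu ^+ 2 <= c1.
Hypothesis c2_ge : 2 / (3 * k ^+ 3) + 9 / 4 <= c2.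
Hypothesis lambda_gt0 : 0 < lambda.
Hypothesis gamma_gt0 : 0 < gamma.
Hypothesis lambda_mu : 32 * (lambda * mu) ^+ 2 <= 9.
Hypothesis lambda_Lf : 2 * Lf * k * lambda <= m `^ 3^-1.
Hypothesis gamma_le : 8 * gamma * (Lf * (2 + Lf / mu)) <= lambda * mu.
Hypothesis alpha_le1 : forall t, (1 <= t)%N -> c1 * eta t ^+ 2 <= 1.
Hypothesis beta_le1 : forall t, (1 <= t)%N -> c2 * eta t ^+ 2 <= 1.
Hypothesis x_1 : forall o, x 1%N o = x1.
Hypothesis y_1 : forall o, y 1%N o = y1.
Hypothesis v_1 : forall o, v 1%N o = grady (fs (xi 1%N o)) x1 y1.
Hypothesis w_1 : forall o, w 1%N o = gradx (fs (xi 1%N o)) x1 y1.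
Hypothesis x_S : forall t o, (1 <= t)%N -> x t.+1 o = x t o - (eta t * gamma) *: w t o.
Hypothesis y_S : forall t o, (1 <= t)%N -> y t.+1 o = y t o + (eta t * lambda) *: v t o.
Hypothesis v_S : forall t o, (1 <= t)%N ->
  v t.+1 o = grady (fs (xi t.+1 o)) (x t.+1 o) (y t.+1 o)
     + (1 - c1 * eta t ^+ 2) *: (v t o - grady (fs (xi t.+1 o)) (x t o) (y t o)).
Hypothesis w_S : forall t o, (1 <= t)%N ->
  w t.+1 o = gradx (fs (xi t.+1 o)) (x t.+1 o) (y t.+1 o)
     + (1 - c2 * eta t ^+ 2) *: (w t o - gradx (fs (xi t.+1 o)) (x t o) (y t o)).

Let m_gt0 : 0 < m.
Proof. exact: lt_le_trans m_ge2. Qed.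

Lemma eta01 t : 0 < eta t <= 1.
Proof. by apply: step_le1. Qed.

Lemma eta_gap t : (1 <= t)%N ->
  (eta t)^-1 - (eta t.-1)^-1 <= 2 / (3 * k ^+ 3) * eta t.
Proof.
case: t => // t _; have := @step_gap R k (m + t%:R) k_gt0.
rewrite /eta /= -(natr1 t) addrA; apply.
  by rewrite (le_trans m_ge2)// lerDl.
by rewrite (le_trans m_gek3)// lerDl.
Qed.

Lemma eta_lambda t : 2 * (eta t * lambda * Lf) <= 1.
Proof.
have b0 : 0 < (m + t%:R) `^ 3^-1 by apply: cbrt_gt0; rewrite ltr_wpDr.
have -> : 2 * (eta t * lambda * Lf) = 2 * Lf * k * lambda / (m + t%:R) `^ 3^-1.
  by rewrite /eta; field; rewrite gt_eqF.
rewrite ler_pdivrMr// mul1r; apply: le_trans lambda_Lf _.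
apply: ler_cube; first exact: ltW.
by rewrite !cbrt_cube ?lerDl ?addr_ge0// ltW.
Qed.

Let k3_gt0 : 0 < 2 / (3 * k ^+ 3).
Proof. by rewrite divr_gt0 ?mulr_gt0 ?exprn_gt0. Qed.

Let c1_gt0 : 0 < c1.
Proof.
apply: lt_le_trans c1_ge; have L0 : 0 <= 9 * Lf ^+ 2 / mu ^+ 2.
  by rewrite divr_ge0 ?sqr_ge0// mulr_ge0// sqr_ge0.
by rewrite ltr_wpDr.
Qed.

Let c2_gt0 : 0 < c2.
Proof. by apply: lt_le_trans c2_ge; rewrite ltr_wpDr. Qed.

Let flip_xx := mean_lipx mean_x lip_xx.
Let flip_xy := mean_lipy mean_x lip_xy.
Let flip_yx := mean_lipx mean_y lip_yx.
Let flip_yy := mean_lipy mean_y lip_yy.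

Let var_x x0 y0 :
  (\int[D]_s (enorm (gradx f x0 y0 - gradx (fs s) x0 y0) ^+ 2)%:E <= (sigma ^+ 2)%:E)%E.
Proof.
apply: le_trans (var_xy x0 y0).
have mx : measurable_fun setT (fun s => enorm (gradx f x0 y0 - gradx (fs s) x0 y0) ^+ 2).
  apply: measurable_sqnorm; apply: row_measurableB => i //.
  by have [/integrableP[/measurable_EFinP]] := mean_x x0 y0 i.
have my : measurable_fun setT (fun s => enorm (grady f x0 y0 - grady (fs s) x0 y0) ^+ 2).
  apply: measurable_sqnorm; apply: row_measurableB => i //.
  by have [/integrableP[/measurable_EFinP]] := mean_y x0 y0 i.
apply: ge0_le_integral => //.
- by move=> s _; rewrite lee_fin sqr_ge0.
- exact/measurable_EFinP.
- by apply/measurable_EFinP; exact: measurable_funD.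
- by move=> s _; rewrite lee_fin lerDl sqr_ge0.
Qed.

Let var_y x0 y0 :
  (\int[D]_s (enorm (grady f x0 y0 - grady (fs s) x0 y0) ^+ 2)%:E <= (sigma ^+ 2)%:E)%E.
Proof.
apply: le_trans (var_xy x0 y0).
have mx : measurable_fun setT (fun s => enorm (gradx f x0 y0 - gradx (fs s) x0 y0) ^+ 2).
  apply: measurable_sqnorm; apply: row_measurableB => i //.
  by have [/integrableP[/measurable_EFinP]] := mean_x x0 y0 i.
have my : measurable_fun setT (fun s => enorm (grady f x0 y0 - grady (fs s) x0 y0) ^+ 2).
  apply: measurable_sqnorm; apply: row_measurableB => i //.
  by have [/integrableP[/measurable_EFinP]] := mean_y x0 y0 i.
apply: ge0_le_integral => //.
- by move=> s _; rewrite lee_fin sqr_ge0.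
- exact/measurable_EFinP.
- by apply/measurable_EFinP; exact: measurable_funD.
- by move=> s _; rewrite lee_fin lerDr sqr_ge0.
Qed.

(* Stated for a general [phi] so that it serves both on [Omega] and on the
   product of the past with a fresh sample. *)
Lemma iterates_measurable dU (U : measurableType dU) (phi : U -> Omega) t : (1 <= t)%N ->
  (forall i, (0 < i <= t)%N -> measurable_fun setT (fun u => xi i (phi u))) ->
  [/\ row_measurable (fun u => x t (phi u)), row_measurable (fun u => y t (phi u)),
      row_measurable (fun u => w t (phi u)) & row_measurable (fun u => v t (phi u))].
Proof.
elim: t => // -[|t] IH _ mxi.
  have m1 : measurable_fun setT (fun u => xi 1%N (phi u)) by exact: mxi.
  have mcx : row_measurable (fun _ : U => x1) by move=> i; exact: measurable_cst.
  have mcy : row_measurable (fun _ : U => y1) by move=> i; exact: measurable_cst.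
  split.
  - by under [fun u => _]eq_fun do rewrite x_1.
  - by under [fun u => _]eq_fun do rewrite y_1.
  - under [fun u => _]eq_fun do rewrite w_1.
    exact: (row_measurable_sample_grad mean_x lip_xx lip_xy m1 mcx mcy).
  - under [fun u => _]eq_fun do rewrite v_1.
    exact: (row_measurable_sample_grad mean_y lip_yx lip_yy m1 mcx mcy).
have [|mx my mw mv] := IH isT.
  by move=> i /andP[i0 it]; apply: mxi; rewrite i0 (leqW it).
have mS : measurable_fun setT (fun u => xi t.+2 (phi u)) by apply: mxi; rewrite /= leqnn.
have mx' : row_measurable (fun u => x t.+2 (phi u)).
  under [fun u => _]eq_fun do rewrite x_S//.
  by apply: row_measurableB => //; exact: row_measurableZ.
have my' : row_measurable (fun u => y t.+2 (phi u)).
  under [fun u => _]eq_fun do rewrite y_S//.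
  by apply: row_measurableD => //; exact: row_measurableZ.
split => //.
- under [fun u => _]eq_fun do rewrite w_S//.
  apply: row_measurableD.
    exact: (row_measurable_sample_grad mean_x lip_xx lip_xy mS mx' my').
  apply: row_measurableZ; apply: row_measurableB => //.
  exact: (row_measurable_sample_grad mean_x lip_xx lip_xy mS mx my).
- under [fun u => _]eq_fun do rewrite v_S//.
  apply: row_measurableD.
    exact: (row_measurable_sample_grad mean_y lip_yx lip_yy mS mx' my').
  apply: row_measurableZ; apply: row_measurableB => //.
  exact: (row_measurable_sample_grad mean_y lip_yx lip_yy mS mx my).
Qed.

Lemma iterates_measurable_Omega t : (1 <= t)%N ->
  [/\ row_measurable (x t), row_measurable (y t), row_measurable (w t) & row_measurable (v t)].
Proof.
move=> t1; apply: (@iterates_measurable _ Omega id) => // i _.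
exact: (measurable_sample iid).
Qed.

Lemma iterates_measurable_past t : (1 <= t)%N ->
  [/\ @row_measurable _ _ (past xi t) _ (x t), @row_measurable _ _ (past xi t) _ (y t),
      @row_measurable _ _ (past xi t) _ (w t) & @row_measurable _ _ (past xi t) _ (v t)].
Proof.
move=> t1; apply: (@iterates_measurable _ (past xi t) id) => // i it.
exact: measurable_sample_past.
Qed.

(** * The Lyapunov function and its expected decrease *)

Let gap t o := F (x t o) - f (x t o) (y t o).
Let erry t o := enorm (grady f (x t o) (y t o) - v t o) ^+ 2.
Let errx t o := enorm (gradx f (x t o) (y t o) - w t o) ^+ 2.
Let A := 9 * gamma * Lf ^+ 2 / (lambda * mu ^+ 2).
Let pot t o := F (x t o) - Fstar + A * gap t o.
(** The sum of the squares of the three terms of the metric. *)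
Let measure2 t o := dotp (w t o) (w t o) + 2 * Lf ^+ 2 / mu * gap t o + errx t o.
(** The errors carry the weight of the preceding step size, which for [t = 1] is [eta 0]; the
    momentum update then changes the weight from [gamma / eta_{t-1}] to [gamma / eta_t]. *)
Let lyap t o := pot t o + gamma / eta t.-1 * (erry t o + errx t o).

Let A_gt0 : 0 < A.
Proof. by rewrite divr_gt0 ?mulr_gt0 ?exprn_gt0. Qed.

Let gap_ge0 t o : 0 <= gap t o.
Proof. by rewrite subr_ge0; exact: max_ge F_max _ _. Qed.

Let pot_ge0 t o : 0 <= pot t o.
Proof. by rewrite addr_ge0 ?subr_ge0// mulr_ge0// ltW. Qed.

Let measure2_ge0 t o : 0 <= measure2 t o.
Proof.
rewrite /measure2 addr_ge0 ?sqr_ge0// addr_ge0 ?dotp_ge0// mulr_ge0//.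
by rewrite divr_ge0 ?(ltW mu_gt0)// mulr_ge0// sqr_ge0.
Qed.

Let measurable_F t : (1 <= t)%N -> measurable_fun setT (fun o => F (x t o)).
Proof.
move=> /iterates_measurable_Omega[mx _ _ _].
apply: (@measurable_caratheodory _ _ _ _ (fun=> F)) => // _ z.
apply: differentiable_continuous.
exact: (differentiable_max diff_fx diff_fy F_max mu_gt0 Lf_gt0 PL flip_xx flip_yx flip_yy).
Qed.

Let measurable_gap t : (1 <= t)%N -> measurable_fun setT (gap t).
Proof.
move=> t1; apply: measurable_funB; first exact: measurable_F.
have [mx my _ _] := iterates_measurable_Omega t1.
apply: (@measurable_caratheodory _ _ _ _ (fun o y0 => f (x t o) y0)) => // [y0|o z].
  apply: (@measurable_caratheodory _ _ _ _ (fun _ x0 => f x0 y0)) => // _ z.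
  exact: (differentiable_continuous (diff_fx z y0)).
exact: (differentiable_continuous (diff_fy (x t o) z)).
Qed.

Let measurable_erry t : (1 <= t)%N -> measurable_fun setT (erry t).
Proof.
move=> /iterates_measurable_Omega[mx my _ mv].
apply: measurable_sqnorm; apply: row_measurableB => //.
exact: (row_measurable_mean_grad mean_y lip_yx lip_yy).
Qed.

Let measurable_errx t : (1 <= t)%N -> measurable_fun setT (errx t).
Proof.
move=> /iterates_measurable_Omega[mx my mw _].
apply: measurable_sqnorm; apply: row_measurableB => //.
exact: (row_measurable_mean_grad mean_x lip_xx lip_xy).
Qed.

Let measurable_pot t : (1 <= t)%N -> measurable_fun setT (pot t).
Proof.
move=> t1; apply: measurable_funD; first by apply: measurable_funB => //; exact: measurable_F.
by apply: measurable_funM => //; exact: measurable_gap.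
Qed.

Let measurable_measure2 t : (1 <= t)%N -> measurable_fun setT (measure2 t).
Proof.
move=> t1; have [_ _ mw _] := iterates_measurable_Omega t1.
apply: measurable_funD; last exact: measurable_errx.
apply: measurable_funD; first exact: measurable_dotp.
by apply: measurable_funM => //; exact: measurable_gap.
Qed.

Let move2 t o :=
  2 * Lf ^+ 2 * eta t ^+ 2 * (gamma ^+ 2 * dotp (w t o) (w t o) + lambda ^+ 2 * dotp (v t o) (v
    t o)).
Let bound (b e : R) t o :=
  (1 - b) ^+ 2 * e + 2 * b ^+ 2 * sigma ^+ 2 + 2 * (1 - b) ^+ 2 * move2 t o.

Let move2_ge0 t o : 0 <= move2 t o.
Proof.
rewrite mulr_ge0//; first by rewrite mulr_ge0 ?sqr_ge0// mulr_ge0 ?sqr_ge0.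
by rewrite addr_ge0// mulr_ge0 ?sqr_ge0 ?dotp_ge0.
Qed.

Let bound_ge0 b e t o : 0 <= e -> 0 <= bound b e t o.
Proof.
move=> e0; rewrite !addr_ge0//; first by rewrite mulr_ge0 ?sqr_ge0.
  by rewrite mulr_ge0 ?sqr_ge0// mulr_ge0 ?sqr_ge0.
by rewrite mulr_ge0// mulr_ge0 ?sqr_ge0.
Qed.

Let move2E t o (X' := x t o - (eta t * gamma) *: w t o) (Y' := y t o + (eta t * lambda) *: v t
  o) :
  2 * Lf ^+ 2 * (dotp (X' - x t o) (X' - x t o) + dotp (Y' - y t o) (Y' - y t o)) = move2 t o.
Proof.
have -> : X' - x t o = - (eta t * gamma) *: w t o by rewrite /X' (addrC (x t o)) addrK scaleNr.
have -> : Y' - y t o = (eta t * lambda) *: v t o by rewrite /Y' (addrC (y t o)) addrK.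
by rewrite !(dotpZl, dotpZr) /move2; ring.
Qed.

Let past_next t : (1 <= t)%N ->
  @row_measurable _ _ (past xi t) _ (fun o => x t o - (eta t * gamma) *: w t o) /\
  @row_measurable _ _ (past xi t) _ (fun o => y t o + (eta t * lambda) *: v t o).
Proof.
move=> /iterates_measurable_past[mx my mw mv]; split.
  by apply: row_measurableB => //; exact: row_measurableZ.
by apply: row_measurableD => //; exact: row_measurableZ.
Qed.

Lemma expect_erry t : (1 <= t)%N ->
  (expect P (erry t.+1) <= expect P (fun o => bound (c1 * eta t ^+ 2) (erry t o) t o))%E.
Proof.
move=> t1; have [mx my mw mv] := iterates_measurable_past t1; have [mx' my'] := past_next t1.
apply: (momentum_step iid mean_y var_y lip_yx lip_yy mx mx' my my' mv (b := c1 * eta t ^+ 2))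
  => o.
  by rewrite /erry (@v_S t o t1) (@x_S t o t1) (@y_S t o t1).
by rewrite move2E.
Qed.

Lemma expect_errx t : (1 <= t)%N ->
  (expect P (errx t.+1) <= expect P (fun o => bound (c2 * eta t ^+ 2) (errx t o) t o))%E.
Proof.
move=> t1; have [mx my mw mv] := iterates_measurable_past t1; have [mx' my'] := past_next t1.
apply: (momentum_step iid mean_x var_x lip_xx lip_xy mx mx' my my' mw (b := c2 * eta t ^+ 2))
  => o.
  by rewrite /errx (@w_S t o t1) (@x_S t o t1) (@y_S t o t1).
by rewrite move2E.
Qed.

Let measurable_bound b (e : Omega -> R) t : (1 <= t)%N -> measurable_fun setT e ->
  measurable_fun setT (fun o => bound b (e o) t o).
Proof.
move=> t1 me; have [_ _ mw mv] := iterates_measurable_Omega t1.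
apply: measurable_funD.
  by apply: measurable_funD => //; exact: measurable_funM.
apply: measurable_funM => //; apply: measurable_funM => //; apply: measurable_funD.
  by apply: measurable_funM => //; exact: measurable_dotp.
by apply: measurable_funM => //; exact: measurable_dotp.
Qed.

(** This is [gamma / eta] times the variance terms [2 alpha^2 sigma^2] and [2 beta^2 sigma^2]. As
    [eta^3 = k^3 / (m + t)], its sum is harmonic and produces the logarithm in [H]. *)
Let noise t := 2 * gamma * (c1 ^+ 2 + c2 ^+ 2) * eta t ^+ 3 * sigma ^+ 2.

Lemma pointwise_step t o : (1 <= t)%N ->
  pot t.+1 o + gamma / eta t * (bound (c1 * eta t ^+ 2) (erry t o) t o
                              + bound (c2 * eta t ^+ 2) (errx t o) t o)
    + gamma * eta t / 4 * measure2 t o <= lyap t o + noise t.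
Proof.
move=> t1; have /andP[e0 e1] := eta01 t.
have al01 : 0 <= c1 * eta t ^+ 2 <= 1 by rewrite alpha_le1// mulr_ge0 ?sqr_ge0// ltW.
have be01 : 0 <= c2 * eta t ^+ 2 <= 1 by rewrite beta_le1// mulr_ge0 ?sqr_ge0// ltW.
have g1 : (eta t)^-1 - (eta t.-1)^-1 <= (c1 - 9 * Lf ^+ 2 / mu ^+ 2) * eta t.
  by apply: le_trans (eta_gap t1) _; rewrite ler_pM2r// lerBrDr.
have g2 : (eta t)^-1 - (eta t.-1)^-1 <= (c2 - 9 / 4) * eta t.
  by apply: le_trans (eta_gap t1) _; rewrite ler_pM2r// lerBrDr.
have := @lyapunov_step _ _ _ f F mu Lf diff_fx diff_fy F_max mu_gt0 Lf_gt0 PL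
  flip_xx flip_xy flip_yx flip_yy lambda gamma (eta t) (eta t.-1) A c1 c2
  (c1 * eta t ^+ 2) (c2 * eta t ^+ 2) (sigma ^+ 2) (x t o) (y t o) (w t o) (v t o)
  lambda_gt0 gamma_gt0 (eta01 t) lambda_mu gamma_le (eta_lambda t) erefl al01 erefl be01 erefl
    g1 g2.
rewrite -(@x_S t o t1) -(@y_S t o t1) /lyap /pot /noise /bound /measure2 /gap -/(errx t o)
  -/(erry t o) -/(move2 t o).
set a1 := F _; set a2 := A * _; set a3 := gamma / _ * _; set a4 := gamma * _ / 4 * _.
set b1 := F _; set b2 := A * _; set b3 := gamma / _ * _; set b4 := _ * sigma ^+ 2.
by move=> h; rewrite addrAC [_ - Fstar + a2]addrAC addrAC [leRHS]addrAC [_ - Fstar + b2]addrAC;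
  lra.
Qed.

Lemma expect_step t : (1 <= t)%N ->
  (expect P (lyap t.+1) + (gamma * eta t / 4)%:E * expect P (measure2 t)
   <= expect P (lyap t) + (noise t)%:E)%E.
Proof.
move=> t1; have /andP[e0 e1] := eta01 t.
have c0 : 0 <= gamma / eta t by rewrite divr_ge0// ltW.
have c4 : 0 <= gamma * eta t / 4 by rewrite divr_ge0// mulr_ge0// ltW.
have n0 : 0 <= noise t.
  rewrite mulr_ge0 ?sqr_ge0// mulr_ge0 ?exprn_ge0 ?(ltW e0)//.
  by rewrite mulr_ge0 ?addr_ge0 ?sqr_ge0// mulr_ge0// ltW.
have mp := @measurable_pot t.+1 isT.
have my := @measurable_erry t.+1 isT; have mx := @measurable_errx t.+1 isT.
have ey o : 0 <= erry t o by exact: sqr_ge0.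
have ex o : 0 <= errx t o by exact: sqr_ge0.
have ey' o : 0 <= erry t.+1 o by exact: sqr_ge0.
have ex' o : 0 <= errx t.+1 o by exact: sqr_ge0.
pose by_ o := bound (c1 * eta t ^+ 2) (erry t o) t o.
pose bx_ o := bound (c2 * eta t ^+ 2) (errx t o) t o.
have mby : measurable_fun setT by_ by apply: measurable_bound => //; exact: measurable_erry.
have mbx : measurable_fun setT bx_ by apply: measurable_bound => //; exact: measurable_errx.
have by0 o : 0 <= by_ o by exact: bound_ge0.
have bx0 o : 0 <= bx_ o by exact: bound_ge0.
have mm := measurable_measure2 t1.
have mlyap : measurable_fun setT (lyap t).
  apply: measurable_funD; first exact: measurable_pot.
  by apply: measurable_funM => //; apply: measurable_funD; [exact: measurable_erry|exact:
    measurable_errx].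
have lyap0 o : 0 <= lyap t o.
  rewrite addr_ge0// mulr_ge0 ?addr_ge0// divr_ge0 ?(ltW gamma_gt0)//.
  by have /andP[/ltW] := eta01 t.-1.
have msum : measurable_fun setT (fun o => gamma / eta t * (by_ o + bx_ o)).
  by apply: measurable_funM => //; exact: measurable_funD.
have sum0 o : 0 <= gamma / eta t * (by_ o + bx_ o).
  by apply: mulr_ge0 => //; exact: addr_ge0.
(* Only the errors need averaging over the fresh sample. They are split off, replaced by their
   bounds in expectation, and reunited with the rest under one integral, where [pointwise_step]
   applies. *)
have -> : expect P (lyap t.+1) =
   (expect P (pot t.+1) + (gamma / eta t)%:E * (expect P (erry t.+1) + expect P (errx t.+1)))%E.
  rewrite -expectD// -expectZ//; last 2 first.
  - exact: measurable_funD.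
  - by move=> o; rewrite addr_ge0.
  rewrite -expectD//.
  - by apply: measurable_funM => //; exact: measurable_funD.
  - by move=> o; apply: mulr_ge0 => //; exact: addr_ge0.
apply: (@le_trans _ _ (expect P (fun o => pot t.+1 o + gamma / eta t * (by_ o + bx_ o)
    + gamma * eta t / 4 * measure2 t o))); last first.
  rewrite -[X in (_ + X)%E](expect_cst P) -expectD//; apply: expect_le.
  - by apply: measurable_funD; [exact: measurable_funD|exact: measurable_funM].
  - exact: measurable_funD.
  - by move=> o; apply: addr_ge0; [exact: addr_ge0|exact: mulr_ge0].
  - by move=> o; exact: pointwise_step.
rewrite expectD//; first last.
- by move=> o; rewrite mulr_ge0.
- by move=> o; rewrite addr_ge0.
- exact: measurable_funM.
- exact: measurable_funD.
rewrite (@expectZ _ _ _ P (gamma * eta t / 4))//; apply: leeD => //.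
rewrite expectD//; apply: leeD => //.
rewrite expectZ//; last 2 first.
- exact: measurable_funD.
- by move=> o; rewrite addr_ge0.
apply: lee_wpmul2l; first by rewrite lee_fin.
rewrite expectD//; apply: leeD; [exact: expect_erry|exact: expect_errx].
Qed.

Lemma expect_lyap1 : (expect P (lyap 1) <=
  (F x1 - Fstar + A * (F x1 - f x1 y1) + gamma / eta 0 * sigma ^+ 2)%:E)%E.
Proof.
have c0 : 0 <= gamma / eta 0 by have /andP[/ltW e0 _] := eta01 0; rewrite divr_ge0// ltW.
pose q s := enorm (gradx f x1 y1 - gradx (fs s) x1 y1) ^+ 2 + enorm (grady f x1 y1 - grady (fs
  s) x1 y1) ^+ 2.
have mq : measurable_fun setT q.
  apply: measurable_funD; apply: measurable_sqnorm; apply: row_measurableB => i //.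
    by have [/integrableP[/measurable_EFinP]] := mean_x x1 y1 i.
  by have [/integrableP[/measurable_EFinP]] := mean_y x1 y1 i.
have q0 s : 0 <= q s by rewrite addr_ge0 ?sqr_ge0.
(* For [t = 0] the past is trivial, and [tonelli_past] says that the first sample has law [D]. *)
pose h (z : past xi 0 * Xi) := (q z.2)%:E.
have mh : measurable_fun setT h.
  by apply/measurable_EFinP; exact: (measurableT_comp mq measurable_snd).
have h0 z : (0 <= h z)%E by rewrite lee_fin.
have Eq : (expect P (fun o => q (xi 1%N o)) <= (sigma ^+ 2)%:E)%E.
  have := tonelli_past iid mh h0; rewrite /h /= /expect => ->.
  rewrite -(expect_cst P (sigma ^+ 2)); apply: ge0_le_integral => //.
  - by move=> o _; apply: integral_ge0 => s _; rewrite lee_fin.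
  - by move=> o _; exact: var_xy.
have E1 o : lyap 1 o = F x1 - Fstar + A * (F x1 - f x1 y1) + gamma / eta 0 * q (xi 1%N o).
  by rewrite /lyap /pot /gap /erry /errx /q x_1 y_1 v_1 w_1 [X in _ + _ * X]addrC.
have mqx : measurable_fun setT (fun o => q (xi 1%N o)).
  exact: (measurableT_comp mq (measurable_sample iid 1)).
rewrite /expect; under eq_integral do rewrite E1.
rewrite -/(expect P (fun o => F x1 - Fstar + A * (F x1 - f x1 y1) + gamma / eta 0 * q (xi 1%N
  o))).
rewrite expectD//; first last.
- by move=> o; rewrite mulr_ge0.
- by move=> o; rewrite addr_ge0 ?subr_ge0// mulr_ge0 ?(ltW A_gt0)// subr_ge0; exact: max_ge
  F_max _ _.
- exact: measurable_funM.
set C0 := F x1 - _ + _; rewrite expect_cst expectZ// (EFinD C0); apply: leeD => //.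
by rewrite (EFinM (gamma / eta 0)); apply: lee_wpmul2l => //; rewrite lee_fin.
Qed.

Let T_ge0 (T : nat) : 0 <= m + T%:R.
Proof. by rewrite addr_ge0// ltW. Qed.

Let H T := (F x1 - Fstar) / (gamma * k) + 9 * Lf ^+ 2 / (k * lambda * mu ^+ 2) * (F x1 - f x1 y1)
  + 2 * sigma ^+ 2 * m `^ 3^-1 / k ^+ 2
  + 2 * k ^+ 2 * (c1 ^+ 2 + c2 ^+ 2) * sigma ^+ 2 * ln (m + T%:R).

Let D1_ge0 : 0 <= F x1 - f x1 y1.
Proof. by rewrite subr_ge0; exact: max_ge F_max _ _. Qed.

Lemma H_ge0 T : 0 <= H T.
Proof.
have h1 : 0 <= (F x1 - Fstar) / (gamma * k).
  by rewrite divr_ge0 ?subr_ge0// mulr_ge0// ltW.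
have h2 : 0 <= 9 * Lf ^+ 2 / (k * lambda * mu ^+ 2) * (F x1 - f x1 y1).
  rewrite mulr_ge0// divr_ge0//; first by rewrite mulr_ge0// sqr_ge0.
  by rewrite mulr_ge0 ?sqr_ge0// mulr_ge0// ltW.
have h3 : 0 <= 2 * sigma ^+ 2 * m `^ 3^-1 / k ^+ 2.
  by rewrite divr_ge0 ?sqr_ge0// mulr_ge0 ?powR_ge0// mulr_ge0// sqr_ge0.
have h4 : 0 <= 2 * k ^+ 2 * (c1 ^+ 2 + c2 ^+ 2) * sigma ^+ 2 * ln (m + T%:R).
  rewrite mulr_ge0//; first by rewrite mulr_ge0 ?sqr_ge0// mulr_ge0 ?addr_ge0 ?sqr_ge0//
    mulr_ge0 ?sqr_ge0.
  have m1 : 1 <= m by apply: le_trans m_ge2; rewrite ler1n.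
  by rewrite ln_ge0// (le_trans m1)// lerDl.
by rewrite /H !addr_ge0.
Qed.

Lemma sum_noise T : \sum_(1 <= t < T.+1) noise t <=
  2 * gamma * k ^+ 3 * (c1 ^+ 2 + c2 ^+ 2) * sigma ^+ 2 * ln (m + T%:R).
Proof.
have nE t : noise t = 2 * gamma * k ^+ 3 * (c1 ^+ 2 + c2 ^+ 2) * sigma ^+ 2 * (m + t%:R)^-1.
  have b0 : 0 < (m + t%:R) `^ 3^-1 by apply: cbrt_gt0; rewrite ltr_wpDr.
  have := cbrt_cube (T_ge0 t); rewrite /noise /eta; set b := _ `^ _ => <-.
  by field; rewrite gt_eqF.
under eq_bigr do rewrite nE.
rewrite -mulr_sumr ler_wpM2l//.
  rewrite mulr_ge0 ?sqr_ge0// mulr_ge0 ?addr_ge0 ?sqr_ge0// mulr_ge0 ?exprn_ge0 ?(ltW k_gt0)//.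
  by rewrite mulr_ge0// ltW.
by apply: sum_inv_le_ln; apply: le_trans m_ge2; rewrite ler1n.
Qed.

Lemma sum_measure2 T : (1 <= T)%N ->
  (\sum_(1 <= t < T.+1) expect P (measure2 t) <= (4 * H T * (m + T%:R) `^ 3^-1)%:E)%E.
Proof.
move=> T1; have /andP[eT0 _] := eta01 T.
have b0 : 0 < (m + T%:R) `^ 3^-1 by apply: cbrt_gt0; rewrite ltr_wpDr.
have c0 : 0 < gamma * eta T / 4 by rewrite divr_gt0// mulr_gt0.
have tel := @telescope_le R (fun t => expect P (lyap t))
  (fun t => (gamma * eta t / 4)%:E * expect P (measure2 t))%E noise T expect_step.
have lyap0 t o : 0 <= lyap t o.
  have /andP[/ltW e0 _] := eta01 t.-1.
  by rewrite addr_ge0// mulr_ge0 ?addr_ge0 ?sqr_ge0// divr_ge0// ltW.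
have le1 : ((gamma * eta T / 4)%:E * \sum_(1 <= t < T.+1) expect P (measure2 t)
    <= (gamma * k * H T)%:E)%E.
  rewrite ge0_sume_distrr; last by move=> t _; exact: expect_ge0.
  (* The step sizes decrease, so the last weight may replace all the others. *)
  apply: (@le_trans _ _ (\sum_(1 <= t < T.+1) (gamma * eta t / 4)%:E * expect P (measure2 t))%E).
    rewrite big_nat_cond [leRHS]big_nat_cond; apply: lee_sum => t /andP[/andP[_ tT] _].
    apply: lee_wpmul2r; first exact: expect_ge0.
    rewrite lee_fin ler_wpM2r// ler_wpM2l ?(ltW gamma_gt0)// /eta.
    have bt0 : 0 < (m + t%:R) `^ 3^-1 by apply: cbrt_gt0; rewrite ltr_wpDr.
    rewrite ler_wpM2l ?(ltW k_gt0)// lef_pV2 ?posrE//.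
    apply: ler_cube; first exact: ltW.
    by rewrite !cbrt_cube// lerD2l ler_nat -ltnS.
  apply: (@le_trans _ _ (expect P (lyap T.+1) +
      \sum_(1 <= t < T.+1) (gamma * eta t / 4)%:E * expect P (measure2 t))%E).
    by rewrite leeDr// expect_ge0.
  apply: (le_trans tel); apply: le_trans (leeD expect_lyap1 (lexx _)) _.
  rewrite -EFinD lee_fin; apply: le_trans (lerD (lexx _) (sum_noise T)) _.
  (* [H] counts the initial variance twice; one copy is slack. *)
  have -> : gamma * k * H T = F x1 - Fstar + A * (F x1 - f x1 y1)
      + 2 * (gamma / eta 0 * sigma ^+ 2)
      + 2 * gamma * k ^+ 3 * (c1 ^+ 2 + c2 ^+ 2) * sigma ^+ 2 * ln (m + T%:R).
    have bm : 0 < m `^ 3^-1 by exact: cbrt_gt0.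
    rewrite /H /A /eta addr0; set L := ln _; set b := m `^ _ in bm *.
    by field; rewrite !gt_eqF.
  have : 0 <= gamma / eta 0 * sigma ^+ 2.
    have /andP[/ltW e0 _] := eta01 0.
    by rewrite mulr_ge0 ?sqr_ge0// divr_ge0// ltW.
  set Z := gamma / eta 0 * _; set n := _ * ln _; lra.
have -> : 4 * H T * (m + T%:R) `^ 3^-1 = (gamma * eta T / 4)^-1 * (gamma * k * H T).
  by rewrite /eta; field; rewrite !gt_eqF.
by rewrite EFinM lee_pdivlMl.
Qed.

(** * The metric and the two final bounds *)

Let metric t o := Gmetric f F gamma mu Lf (x t o) (y t o) (w t o) (x t o - gamma *: w t o).
Let gapn t o := Num.sqrt 2 * Lf / Num.sqrt mu * Num.sqrt (gap t o).

Let metricE t o :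
  metric t o = enorm (w t o) + gapn t o + enorm (gradx f (x t o) (y t o) - w t o).
Proof.
rewrite /metric /Gmetric opprB addrCA subrr addr0 enormZ gtr0_norm// mulrA mulVf ?mul1r//.
by rewrite gt_eqF.
Qed.

Let gapn_ge0 t o : 0 <= gapn t o.
Proof. by rewrite mulr_ge0 ?sqrtr_ge0// divr_ge0 ?sqrtr_ge0// mulr_ge0 ?sqrtr_ge0// ltW. Qed.

Let gapn_sqr t o : gapn t o ^+ 2 = 2 * Lf ^+ 2 / mu * gap t o.
Proof.
by rewrite /gapn !exprMn exprVn !sqr_sqrtr ?(ltW mu_gt0).
Qed.

Lemma metric_ge0 t o : 0 <= metric t o.
Proof. by rewrite metricE !addr_ge0 ?enorm_ge0. Qed.

Lemma metric_sqr_le t o : metric t o ^+ 2 <= 3 * measure2 t o.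
Proof.
rewrite metricE /measure2 -gapn_sqr -enorm_sqr /errx.
set a := enorm _; set b := gapn t o; set c := enorm _.
have := sqr_ge0 (a - b); have := sqr_ge0 (b - c); have := sqr_ge0 (a - c).
by rewrite !expr2; lra.
Qed.

(** Triangle inequality for [w + (G - g) + (g - w)]; by [grad_gap] the middle term is at most the
    second term of the metric. *)
Lemma gradient_le_metric t o : enorm (gradient F (x t o)) <= metric t o.
Proof.
rewrite metricE; set G := gradient F _; set g := gradx f _ _.
have h1 : enorm (G - g) <= gapn t o.
  rewrite -(@ler_pXn2r _ 2) ?nnegrE ?enorm_ge0// gapn_sqr.
  exact: (grad_gap diff_fx diff_fy F_max mu_gt0 Lf_gt0 PL flip_xx flip_xy flip_yx flip_yy).
have h2 := enormD (w t o) ((G - g) + (g - w t o)); have h3 := enormD (G - g) (g - w t o).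
have E : w t o + ((G - g) + (g - w t o)) = G by rewrite (addrA (G - g)) subrK addrCA subrr addr0.
move: h1 h2 h3; rewrite E; set e1 := enorm G; set e2 := enorm (G - g); set e3 := enorm (_ + _).
set e4 := enorm (w t o); set e5 := enorm _; set e6 := gapn t o; clearbody e1 e2 e3 e4 e5 e6; lra.
Qed.

Lemma measurable_metric t : (1 <= t)%N -> measurable_fun setT (metric t).
Proof.
move=> t1; have [mx my mw _] := iterates_measurable_Omega t1.
rewrite (_ : metric t = fun o => enorm (w t o) + gapn t o + enorm (gradx f (x t o) (y t o) - w
  t o)); last first.
  by apply/funext => o; exact: metricE.
apply: measurable_funD; first apply: measurable_funD; first exact: measurable_enorm.
  by apply: measurable_funM => //; apply: measurable_sqrtr; exact: measurable_gap.
apply: measurable_enorm; apply: row_measurableB => //.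
exact: (row_measurable_mean_grad mean_x lip_xx lip_xy).
Qed.

Lemma measurable_gradient_max t : (1 <= t)%N ->
  measurable_fun setT (fun o => enorm (gradient F (x t o))).
Proof.
move=> t1; have [mx _ _ _] := iterates_measurable_Omega t1.
apply: measurable_enorm => i.
apply: (@measurable_caratheodory _ _ _ _ (fun _ z => gradient F z ord0 i)) => // _.
apply: (@lipschitz_continuous _ _ _ (Lf * (1 + Lf / mu))) => z z'.
have h := gradient_max_lipschitz diff_fx diff_fy F_max mu_gt0 Lf_gt0 PL
  flip_xx flip_xy flip_yx flip_yy z z'.
apply: le_trans h.
by have := normr_le_enorm (gradient F z - gradient F z') i; rewrite !mxE.
Qed.

Lemma differentiable_value x0 : differentiable F x0.
Proof.
exact: (differentiable_max diff_fx diff_fy F_max mu_gt0 Lf_gt0 PL flip_xx flip_yx flip_yy).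
Qed.

Lemma expect_gradient_le T :
  ((T%:R^-1)%:E * \sum_(1 <= t < T.+1) \int[P]_o (enorm (gradient F (x t o)))%:E
   <= (T%:R^-1)%:E * \sum_(1 <= t < T.+1) \int[P]_o (metric t o)%:E)%E.
Proof.
apply: lee_wpmul2l; first by rewrite lee_fin invr_ge0.
rewrite big_nat_cond [leRHS]big_nat_cond; apply: lee_sum => t /andP[/andP[t1 _] _].
apply: expect_le; [exact: measurable_gradient_max|exact: measurable_metric| |].
  by move=> o; exact: enorm_ge0.
by move=> o; exact: gradient_le_metric.
Qed.

Lemma expect_metric_le T : (1 <= T)%N ->
  ((T%:R^-1)%:E * \sum_(1 <= t < T.+1) \int[P]_o (metric t o)%:E
   <= (2 * Num.sqrt (3 * H T) * m `^ (6^-1) / T%:R `^ (2^-1)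
       + 2 * Num.sqrt (3 * H T) / T%:R `^ (3^-1))%:E)%E.
Proof.
move=> T1; apply: (@expect_avg_le _ _ _ P metric measure2 T (4 * H T * (m + T%:R) `^ 3^-1)) => //.
- exact: measurable_metric.
- exact: metric_ge0.
- by move=> t o _; exact: metric_sqr_le.
- by rewrite addr_ge0// divr_ge0 ?powR_ge0// mulr_ge0 ?powR_ge0// mulr_ge0 ?sqrtr_ge0.
- have T1' : 1 <= T%:R :> R by rewrite ler1n.
  apply: le_trans (rate_bound (H_ge0 T) m_gt0 T1').
  by rewrite !mulrA (_ : 3 * 4 = 12 :> R) -?natrM.
- exact: sum_measure2.
Qed.

End msgda.

Theorem theorem1
  (R : realType) (d p : nat)
  (dO : measure_display) (Omega : measurableType dO) (P : probability Omega R)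
  (dX : measure_display) (Xi : measurableType dX) (D : probability Xi R)
  (xi : nat -> Omega -> Xi)
  (fs : Xi -> 'rV[R]_d -> 'rV[R]_p -> R)   (* f(x,y;xi) *)
  (f : 'rV[R]_d -> 'rV[R]_p -> R)          (* f(x,y) *)
  (F : 'rV[R]_d -> R) (Fstar mu Lf sigma : R)
  (k m c1 c2 lambda gamma : R)
  (x1 : 'rV[R]_d) (y1 : 'rV[R]_p)
  (x xtil w : nat -> Omega -> 'rV[R]_d) (y ytil v : nat -> Omega -> 'rV[R]_p) :
  (* i.i.d. samples xi_1, xi_2, ... with law D *)
  iid_samples P D xi ->
  (* stochastic and deterministic objectives: differentiability, f = E f(.;xi) *)
  (forall s x0 y0, differentiable (fun x' => fs s x' y0) x0 /\
                   differentiable (fun y' => fs s x0 y') y0) ->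
  (forall x0 y0, differentiable (fun x' => f x' y0) x0 /\
                 differentiable (fun y' => f x0 y') y0) ->
  (forall x0 y0, D.-integrable setT (fun s => (fs s x0 y0)%:E) /\
                 (f x0 y0)%:E = (\int[D]_s (fs s x0 y0)%:E)%E) ->
  (* F(x) = max_y f(x,y), with the argmax nonempty *)
  (forall x0, exists ys, (forall y0, f x0 y0 <= f x0 ys) /\ F x0 = f x0 ys) ->
  (* (A1) PL condition in y *)
  0 < mu ->
  (forall x0 y0, enorm (grady f x0 y0) ^+ 2 >= 2 * mu * (F x0 - f x0 y0)) ->
  (* (A2) Lipschitz stochastic partial gradients *)
  (forall s x0 x' y0, enorm (gradx (fs s) x0 y0 - gradx (fs s) x' y0) <= Lf * enorm (x0 - x')) ->
  (forall s x0 y0 y', enorm (gradx (fs s) x0 y0 - gradx (fs s) x0 y') <= Lf * enorm (y0 - y')) ->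
  (forall s x0 x' y0, enorm (grady (fs s) x0 y0 - grady (fs s) x' y0) <= Lf * enorm (x0 - x')) ->
  (forall s x0 y0 y', enorm (grady (fs s) x0 y0 - grady (fs s) x0 y') <= Lf * enorm (y0 - y')) ->
  (* (A3) unbiased stochastic gradients with bounded variance *)
  (forall x0 y0 (i : 'I_d),
      D.-integrable setT (fun s => ((gradx (fs s) x0 y0) ord0 i)%:E) /\
      (\int[D]_s ((gradx (fs s) x0 y0) ord0 i)%:E)%E = ((gradx f x0 y0) ord0 i)%:E) ->
  (forall x0 y0 (j : 'I_p),
      D.-integrable setT (fun s => ((grady (fs s) x0 y0) ord0 j)%:E) /\
      (\int[D]_s ((grady (fs s) x0 y0) ord0 j)%:E)%E = ((grady f x0 y0) ord0 j)%:E) ->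
  (forall x0 y0,
      (\int[D]_s (enorm (gradx f x0 y0 - gradx (fs s) x0 y0) ^+ 2
                  + enorm (grady f x0 y0 - grady (fs s) x0 y0) ^+ 2)%:E
       <= (sigma ^+ 2)%:E)%E) ->
  (* (A4) F^* = inf_x F(x) is finite *)
  (forall x0, Fstar <= F x0) ->
  (forall e, 0 < e -> exists x0, F x0 < Fstar + e) ->
  (* parameters *)
  let kappa := Lf / mu in
  let L := Lf * (1 + kappa / 2) in
  let eta := fun t : nat => k / (m + t%:R) `^ (3^-1) in
  let alpha := fun t : nat => c1 * eta t.-1 ^+ 2 in   (* alpha_{t+1} = c1 eta_t^2 *)
  let beta := fun t : nat => c2 * eta t.-1 ^+ 2 in    (* beta_{t+1} = c2 eta_t^2 *)
  0 < k ->
  Num.max (Num.max 2 (k ^+ 3)) (Num.max ((c1 * k) ^+ 3) ((c2 * k) ^+ 3)) <= m ->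
  2 / (3 * k ^+ 3) + 9 * Lf ^+ 2 / mu ^+ 2 <= c1 ->
  2 / (3 * k ^+ 3) + 9 / 4 <= c2 ->
  0 < lambda ->
  lambda <= Num.min (3 / (4 * Num.sqrt 2 * mu)) (m `^ (3^-1) / (2 * Lf * k)) ->
  0 < gamma ->
  gamma <= Num.min (lambda * mu / (16 * L))
                   (1 / (2 * Lf * Num.sqrt (8 + 9 / (8 * lambda * mu ^+ 2)))) ->
  (* the algorithm requires alpha_t, beta_t in (0,1] *)
  (forall t, (2 <= t)%N -> alpha t <= 1 /\ beta t <= 1) ->
  (* MSGDA iterates *)
  (forall o, x 1%N o = x1 /\ y 1%N o = y1 /\
             v 1%N o = grady (fs (xi 1%N o)) x1 y1 /\
             w 1%N o = gradx (fs (xi 1%N o)) x1 y1) ->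
  (forall t o, (1 <= t)%N ->
     [/\ ytil t.+1 o = y t o + lambda *: v t o,
         xtil t.+1 o = x t o - gamma *: w t o,
         y t.+1 o = y t o + eta t *: (ytil t.+1 o - y t o),
         x t.+1 o = x t o + eta t *: (xtil t.+1 o - x t o) &
        v t.+1 o = grady (fs (xi t.+1 o)) (x t.+1 o) (y t.+1 o)
                    + (1 - alpha t.+1) *: (v t o - grady (fs (xi t.+1 o)) (x t o) (y t o))
        /\ w t.+1 o = gradx (fs (xi t.+1 o)) (x t.+1 o) (y t.+1 o)
                    + (1 - beta t.+1) *: (w t o - gradx (fs (xi t.+1 o)) (x t o) (y t o))]) ->
  (* conclusion *)
  (forall x0, differentiable F x0) /\
  forall T : nat, (1 <= T)%N ->
    let Delta1 := F x1 - f x1 y1 in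
    let H := (F x1 - Fstar) / (gamma * k) + 9 * Lf ^+ 2 / (k * lambda * mu ^+ 2) * Delta1
             + 2 * sigma ^+ 2 * m `^ (3^-1) / k ^+ 2
             + 2 * k ^+ 2 * (c1 ^+ 2 + c2 ^+ 2) * sigma ^+ 2 * ln (m + T%:R) in
    let EgradF := ((T%:R^-1)%:E * \sum_(1 <= t < T.+1)
                    \int[P]_o (enorm (gradient F (x t o)))%:E)%E in
    let EG := ((T%:R^-1)%:E * \sum_(1 <= t < T.+1)
                \int[P]_o (Gmetric f F gamma mu Lf (x t o) (y t o) (w t o) (xtil t.+1 o))%:E)%E in
    (EgradF <= EG)%E /\
    (EG <= (2 * Num.sqrt (3 * H) * m `^ (6^-1) / T%:R `^ (2^-1)
           + 2 * Num.sqrt (3 * H) / T%:R `^ (3^-1))%:E)%E.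
Proof.
move=> iid _ diff_f _ F_max mu_gt0 PL lip_xx lip_xy lip_yx lip_yy mean_x mean_y var_xy F_lb _.
move=> kappa L eta alpha beta k_gt0 m_ge c1_ge c2_ge lambda_gt0 lambda_le gamma_gt0 gamma_le
  ab_le1 init rec.
have m_ge2 : 2 <= m by apply: le_trans m_ge; rewrite !le_max lexx.
have m_gek3 : k ^+ 3 <= m by apply: le_trans m_ge; rewrite !le_max lexx orbT.
move: lambda_le gamma_le; rewrite !le_min => /andP[lambda_le1 lambda_le2] /andP[gamma_le1 _].
(* The positive [lambda] lies below [m^(1/3) / (2 Lf k)], so this quotient is positive; for [Lf = 0]
   it would be 0 by convention. *)
have Lf_gt0 : 0 < Lf.
  have := lt_le_trans lambda_gt0 lambda_le2.
  have b0 : 0 < m `^ 3^-1 by apply: cbrt_gt0; exact: lt_le_trans m_ge2.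
  by rewrite pmulr_rgt0// invr_gt0 pmulr_lgt0// pmulr_rgt0.
have L_gt0 : 0 < L by rewrite mulr_gt0// ltr_wpDr// !divr_ge0// ltW.
have lambda_mu : 32 * (lambda * mu) ^+ 2 <= 9.
  have s2 : 0 < Num.sqrt 2 :> R by rewrite sqrtr_gt0.
  move: lambda_le1; rewrite ler_pdivlMr ?mulr_gt0// => h.
  have : (lambda * (4 * Num.sqrt 2 * mu)) ^+ 2 <= 3 ^+ 2.
    by rewrite ler_pXn2r ?nnegrE// mulr_ge0 ?(ltW lambda_gt0)// !mulr_ge0// ltW.
  by rewrite !exprMn sqr_sqrtr//; lra.
have lambda_Lf : 2 * Lf * k * lambda <= m `^ 3^-1.
  by move: lambda_le2; rewrite ler_pdivlMr ?mulr_gt0// mulrC.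
(* [16 L] is [8 Lf (2 + Lf / mu)]. *)
have gamma_L : 8 * gamma * (Lf * (2 + Lf / mu)) <= lambda * mu.
  have L16 : 0 < 16 * L by rewrite mulr_gt0.
  move: gamma_le1; rewrite (ler_pdivlMr _ _ L16) /L /kappa.
  by congr (_ <= _); field; rewrite gt_eqF.
have al1 t : (1 <= t)%N -> c1 * eta t ^+ 2 <= 1 by move=> t1; have [] := ab_le1 t.+1 t1.
have be1 t : (1 <= t)%N -> c2 * eta t ^+ 2 <= 1 by move=> t1; have [] := ab_le1 t.+1 t1.
have x_1 o : x 1%N o = x1 by have [] := init o.
have y_1 o : y 1%N o = y1 by have [_ []] := init o.
have v_1 o : v 1%N o = grady (fs (xi 1%N o)) x1 y1 by have [_ [_ []]] := init o.
have w_1 o : w 1%N o = gradx (fs (xi 1%N o)) x1 y1 by have [_ [_ []]] := init o.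
have xtilE t o : (1 <= t)%N -> xtil t.+1 o = x t o - gamma *: w t o by move=> /(rec t o)[].
have x_S t o : (1 <= t)%N -> x t.+1 o = x t o - (eta t * gamma) *: w t o.
  move=> t1; have [_ -> _ -> _] := rec t o t1.
  by rewrite (addrC (x t o) (- _)) addrK scalerN scalerA.
have y_S t o : (1 <= t)%N -> y t.+1 o = y t o + (eta t * lambda) *: v t o.
  move=> t1; have [-> _ -> _ _] := rec t o t1.
  by rewrite (addrC (y t o) (_ *: v t o)) addrK scalerA.
have v_S t o : (1 <= t)%N ->
    v t.+1 o = grady (fs (xi t.+1 o)) (x t.+1 o) (y t.+1 o)
      + (1 - c1 * eta t ^+ 2) *: (v t o - grady (fs (xi t.+1 o)) (x t o) (y t o)).
  by move=> /(rec t o)[_ _ _ _ []].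
have w_S t o : (1 <= t)%N ->
    w t.+1 o = gradx (fs (xi t.+1 o)) (x t.+1 o) (y t.+1 o)
      + (1 - c2 * eta t ^+ 2) *: (w t o - gradx (fs (xi t.+1 o)) (x t o) (y t o)).
  by move=> /(rec t o)[_ _ _ _ []].
have diff_fx x0 y0 := (diff_f x0 y0).1; have diff_fy x0 y0 := (diff_f x0 y0).2.
split.
  exact: (differentiable_value diff_fx diff_fy F_max mu_gt0 Lf_gt0 PL
    lip_xx lip_yx lip_yy mean_x mean_y).
move=> T T1 Delta1 H EgradF EG.
have -> : EG = ((T%:R^-1)%:E * \sum_(1 <= t < T.+1) \int[P]_o
    (Gmetric f F gamma mu Lf (x t o) (y t o) (w t o) (x t o - gamma *: w t o))%:E)%E.
  congr (_ * _)%E; rewrite big_nat_cond [RHS]big_nat_cond.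
  apply: eq_bigr => t /andP[/andP[t1 _] _].
  by apply: eq_integral => o _; rewrite xtilE.
split.
  apply: (@expect_gradient_le _ _ _ _ _ P _ _ D xi fs f F mu Lf k m c1 c2 lambda gamma x1 y1 x
    w y v) => //.
exact: (@expect_metric_le _ _ _ _ _ P _ _ D xi fs f F Fstar mu Lf sigma k m c1 c2 lambda gamma
  x1 y1 x w y v).
Qed.
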